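(* Let $\alpha\in(\tfrac12,1)$, $s=p^{1-\alpha}$, and $A=\sqrt{2r\log p/n}$ with $r>\alpha$. Assume either $\mathbf X\in\mathrm{SubG}(\sigma^2)$ with $n/p^{3/2}\to\infty$, or $\mathbf X\in\mathcal O_n(p)$ with $n\ge p$. For $t\in\mathbb R$ let $\xi(t)=\mathbf 1\big(\max_{j\in[p]}|z_j|>t\big)$. Then $$\liminf_{p\to\infty}\frac{\log\inf_{t}\mathrm{Risk}(\xi(t),s,A)}{s\log p}>-\frac{(r-\alpha)^2}{4r}.$$
   Context: Setting: for each $p$ one observes $(\mathbf y,\mathbf X)$ with $\mathbf y=\mathbf X\boldsymbol\beta+\boldsymbol\varepsilon$, where $\boldsymbol\varepsilon\sim\mathcal N(0,I_n)$, $\mathbf X$ is an $n\times p$ real matrix independent of $\boldsymbol\varepsilon$, $\boldsymbol\beta\in\mathbb R^p$ is unknown, and $n=n(p)\to\infty$ as $p\to\infty$. Design classes: $\mathbf X\in\mathrm{SubG}(\sigma^2)$ means the rows of $\mathbf X$ are i.i.d. centered isotropic ($\mathbb E[xx^T]=I_p$) sub-Gaussian random vectors with sub-Gaussian parameter $\sigma^2$ (for every unit $u$ and $t\in\mathbb R$, $\log\mathbb E e^{t\langle u,x\rangle}\le\sigma^2t^2/2$), and $\mathbf X^T\mathbf X$ is almost surely positive definite; $\mathbf X\in\mathcal O_n(p)$ means $\mathbf X^T\mathbf X=nI_p$. For an integer $s$ and $A>0$, $\Xi(s,A)=\{\boldsymbol\beta\in\mathbb R^p:|\mathrm{supp}(\boldsymbol\beta)|=s,\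 |\beta_i|\ge A\text{ for }i\in\mathrm{supp}(\boldsymbol\beta)\}$. A test $T$ is a measurable $[0,1]$-valued function of $(\mathbf y,\mathbf X)$; $\mathbb E_{\boldsymbol\beta}$ denotes expectation over $(\mathbf y,\mathbf X)$ under parameter $\boldsymbol\beta$, $\mathbb E_0$ under $\boldsymbol\beta=0$. $\mathrm{Risk}(T,s,A)=\mathbb E_0[T]+\sup_{\boldsymbol\beta\in\Xi(s,A)}\mathbb E_{\boldsymbol\beta}[1-T]$. The vector $\mathbf z=(z_1,\dots,z_p)=(\mathbf X^T\mathbf X)^{-1/2}\mathbf X^T\mathbf y$, where $(\mathbf X^T\mathbf X)^{-1/2}=OD^{-1/2}O^T$ for a spectral decomposition $\mathbf X^T\mathbf X=ODO^T$. *)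

(* Defs.v *)
From HB Require Import structures.
From mathcomp Require Import all_boot all_order all_algebra.
From mathcomp Require Import all_classical all_reals all_analysis.
Set Implicit Arguments. Unset Strict Implicit. Unset Printing Implicit Defensive.
Import Order.TTheory GRing.Theory Num.Theory.
Import numFieldNormedType.Exports.
Local Open Scope classical_set_scope.
Local Open Scope ring_scope.

Section Defs.
Variable R : realType.

Definition posdef (m : nat) (M : 'M[R]_m) : Prop :=
  forall v : 'cV[R]_m, v != 0 -> 0 < (v^T *m M *m v) 0 0.

Definition spec_decomp (m : nat) (M : 'M[R]_m) (Od : 'M[R]_m * 'rV[R]_m) : Prop :=
  Od.1^T *m Od.1 = 1%:M /\ (forall i, 0 < Od.2 0 i) /\
  M = Od.1 *m diag_mx Od.2 *m Od.1^T.

(* M^{-1/2} := O D^{-1/2} O^T for a spectral decomposition of M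
   (default value 0 if M is not positive definite: a null event here) *)
Definition invsqrt (m : nat) (M : 'M[R]_m) : 'M[R]_m :=
  match pselect (exists Od, spec_decomp M Od) with
  | left e => let Od := projT1 (cid e) in
      Od.1 *m diag_mx (\row_i (Num.sqrt (Od.2 0 i))^-1) *m Od.1^T
  | right _ => 0
  end.

Definition zvec (n p : nat) (X : 'M[R]_(n, p)) (y : 'cV[R]_n) : 'cV[R]_p :=
  invsqrt (X^T *m X) *m (X^T *m y).

Definition maxabs (p : nat) (z : 'cV[R]_p) : R :=
  \big[Num.max/0]_(j < p) `|z j 0|.

Definition xi_test (n p : nat) (t : R) (y : 'cV[R]_n) (X : 'M[R]_(n, p)) : R :=
  if t < maxabs (zvec X y) then 1 else 0.

Definition Xi (p s : nat) (A : R) : set 'cV[R]_p :=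
  [set b | #|[set j : 'I_p | b j 0 != 0]| = s /\
           forall j, b j 0 != 0 -> A <= `|b j 0|].

Section Model.
Context (d : measure_display) (Omega : measurableType d) (P : probability Omega R)
        (n p : nat) (X : Omega -> 'M[R]_(n, p)) (eps : Omega -> 'cV[R]_n).

Definition Ebeta (T : 'cV[R]_n -> 'M[R]_(n, p) -> R) (beta : 'cV[R]_p) : R :=
  fine (\int[P]_w (T (X w *m beta + eps w) (X w))%:E)%E.

Definition Risk (T : 'cV[R]_n -> 'M[R]_(n, p) -> R) (s : nat) (A : R) : R :=
  Ebeta T 0 + sup [set Ebeta (fun y M => 1 - T y M) b | b in Xi s A].

(* eps ~ N(0, I_n), independent of X (product rule on cylinder events) *)
Definition gauss_indep : Prop :=
  (forall i, measurable_fun setT (fun w => eps w i 0)) /\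
  (forall k l, measurable_fun setT (fun w => X w k l)) /\
  forall (B : 'I_n -> set R) (C : 'I_n -> 'I_p -> set R),
    (forall i, measurable (B i)) -> (forall k l, measurable (C k l)) ->
    P [set w | (forall i, eps w i 0 \in B i) /\ (forall k l, X w k l \in C k l)] =
    ((\prod_(i < n) normal_prob 0 1 (B i)) *
       P [set w | forall k l, X w k l \in C k l])%E.

Definition SubG (sigma2 : R) : Prop :=
  (forall C : 'I_n -> 'I_p -> set R, (forall k l, measurable (C k l)) ->
     P [set w | forall k l, X w k l \in C k l] =
     (\prod_(k < n) P [set w | forall l, X w k l \in C k l])%E) /\
  (forall (B : 'I_p -> set R) (k k' : 'I_n), (forall l, measurable (B l)) ->
     P [set w | forall l, X w k l \in B l] = P [set w | forall l, X w k' l \in B l]) /\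
  (forall k l, (\int[P]_w (X w k l)%:E = 0)%E) /\
  (forall k l m, (\int[P]_w (X w k l * X w k m)%:E = (l == m)%:R%:E)%E) /\
  (forall k (u : 'rV[R]_p) (t : R), \sum_l u 0 l ^+ 2 = 1 ->
     (\int[P]_w (expR (t * \sum_l u 0 l * X w k l))%:E
        <= (expR (sigma2 * t ^+ 2 / 2))%:E)%E) /\
  {ae P, forall w, posdef ((X w)^T *m X w)}.

Definition Orth : Prop := forall w, (X w)^T *m X w = (n%:R)%:M.

End Model.

Definition elog (x : R) : \bar R := if 0 < x then (ln x)%:E else -oo%E.

End Defs.

(* Main.v *)
Require Import Defs.
From HB Require Import structures.
From mathcomp Require Import all_boot all_order all_algebra.
From mathcomp Require Import all_classical all_reals all_analysis.
From mathcomp Require Import measurable_realfun.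
From mathcomp Require Import spectral sesquilinear complex ring lra.
Import Order.TTheory GRing.Theory Num.Theory.
Import numFieldNormedType.Exports.
Local Open Scope classical_set_scope.
Local Open Scope ring_scope.
Set Implicit Arguments. Unset Strict Implicit. Unset Printing Implicit Defensive.

(** The threshold test cannot have exponentially small risk at speed [s log p], at any
    positive rate.  Fix a small [kappa > 0] and let [t0 ^ 2 = kappa s log p].  If
    [t <= t0], then already a single null coordinate [z_j ~ N(0, 1)] exceeds [t] with
    probability at least [exp (- (2 t0 + 2) ^ 2) / 4].  If [t > t0], the threshold is
    far above both the signals, of size [sqrt (2 r log p)], and the noise, so that the
    type II error is at least 1/2 for some [beta].  To find this [beta], average over
    all sign patterns of a spike of height [A] on the first [s] coordinates: with
    [M = X^T X], the exponential moments of [(M^(1/2) beta)_j] are then controlled by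
    [A ^ 2 M_jj] alone, and [M_jj <= 2 sqrt s n] for all [j] outside a small event.
    Conditionally on the design, [(X^T X)^(-1/2) X^T eps] has standard normal
    coordinates; only their moment generating function is needed. *)

(** * Real spectral theorem *)

(** Why signs must be averaged: row [j] of [M^(1/2)] has squared norm [M_jj], typically of order
    [n], so for a fixed [beta] Cauchy-Schwarz only bounds [(M^(1/2) beta)_j] by about
    [A sqrt (s n)], whose square [2 r s log p] exceeds [t0 ^ 2 = kappa s log p]. Under random signs
    the same coordinate is sub-Gaussian with variance proxy of order [A ^ 2 M_jj], at most of order
    [sqrt s log p], far below [t0 ^ 2]. The room between [sqrt s] and [s] also permits the crude
    bound [M_jj <= 2 sqrt s n]: it fails for a given column with probability of order
    [exp (- s^(1/4) / 2)], which beats a union over [p] columns since [s] is essentially a power of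
    [p]. The other obstacle is measure-theoretic: [invsqrt] picks an eigenbasis by choice, and
    independence is given on cylinder events only. Measurability of [z] and the Gaussian moment
    generating function given the design therefore have to be established first. *)

Lemma symmetric_eigenvalue (R : realType) (n : nat) (A : 'M[R]_n.+1) :
  A^T = A -> exists a, eigenvalue A a.
Proof.
move=> As.
(* Over the complex numbers the matrix is hermitian, so its spectral diagonal is real; a real
   eigenvalue of [Ac] is a root of the real characteristic polynomial, hence an eigenvalue of [A]
   itself. *)
pose Ac : 'M[R[i]]_n.+1 := map_mx (real_complex R) A.
have Ah : Ac \is hermsymmx.
  apply: realsym_hermsym.
    apply/is_hermitianmxP; rewrite expr0 scale1r /Ac.
    by rewrite map_mx_id //; apply/matrixP => i j; rewrite !mxE -[in LHS]As mxE.
  by apply/mxOverP => i j; rewrite mxE complex_real.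
have /hermitian_normalmx/orthomx_spectralP AE := Ah.
have /mxOverP/(_ ord0 ord0) := hermitian_spectral_diag_real Ah.
set P := spectralmx Ac in AE *; set sp := spectral_diag Ac in AE *.
move=> /complex_realP [a spa].
exists a; rewrite eigenvalue_root_char -(fmorph_root (real_complex R)).
rewrite map_char_poly -/Ac -eigenvalue_root_char.
apply/eigenvalueP; exists (row ord0 P).
  rewrite AE !mulmxA -!row_mul mulmxV ?spectral_unit// mul1mx row_mul.
  rewrite row_diag_mx spa -scalemxAl -rowE. by [].
apply/eqP => P0.
have := spectral_unit Ac; rewrite -/P => /mulmxV /(congr1 (row ord0)).
rewrite row_mul P0 mul0mx => /rowP/(_ ord0); rewrite !mxE eqxx => /esym/eqP.
by rewrite oner_eq0.
Qed.

Lemma norm_row_eq0 (R : realType) (n : nat) (v : 'rV[R]_n) :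
  ((v *m v^T) 0 0 == 0) = (v == 0).
Proof.
apply/idP/eqP => [|->]; last by rewrite mul0mx mxE.
rewrite mxE psumr_eq0 => [/allP H|i _]; last by rewrite mxE -expr2 sqr_ge0.
apply/rowP => i; have := H i (mem_index_enum _).
by rewrite !mxE mulf_eq0 orbb => /eqP.
Qed.

(* The Householder reflection exchanging the first basis vector and [v]. *)
Lemma orthogonal_first_row (R : realType) (n : nat) (v : 'rV[R]_n.+1) :
  v *m v^T = 1%:M ->
  exists Q : 'M[R]_n.+1, [/\ Q^T = Q, Q *m Q = 1%:M & row ord0 Q = v].
Proof.
move=> v1; pose e : 'rV[R]_n.+1 := delta_mx ord0 ord0.
have e1 : e *m e^T = 1%:M.
  by rewrite trmx_delta mul_delta_mx; apply/matrixP => i j; rewrite !mxE !ord1.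
have [->|ve] := eqVneq v e.
  by exists 1%:M; rewrite trmx1 mulmx1 row1; split.
pose u := v - e; pose c := (u *m u^T) 0 0.
have c0 : c != 0 by rewrite norm_row_eq0 subr_eq0.
have uu : u *m u^T = c%:M by rewrite [LHS]mx11_scalar.
exists (1%:M - (2 / c) *: (u^T *m u)); split.
- by rewrite linearB /= linearZ /= trmx_mul trmxK trmx1.
- have : (u^T *m u) *m (u^T *m u) = c *: (u^T *m u).
    by rewrite -(mulmxA u^T) (mulmxA u) uu mul_scalar_mx -scalemxAr.
  move: (u^T *m u) => S SS.
  rewrite mulmxBl mul1mx mulmxBr mulmx1 -scalemxAl -scalemxAr scalerA SS scalerA.
  have -> : 2 / c * (2 / c) * c = 2 / c + 2 / c :> R by field.
  by rewrite scalerDl opprB addrK subrK.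
- pose d := (e *m v^T) 0 0.
  have evE : e *m v^T = d%:M by rewrite [LHS]mx11_scalar.
  have veE : v *m e^T = d%:M by rewrite -(trmxK v) -trmx_mul evE tr_scalar_mx.
  have eu : e *m u^T = (d - 1)%:M.
    by rewrite linearB /= mulmxBr e1 evE raddfB.
  have vu : c = 2 * (1 - d).
    rewrite /c {1}/u mulmxBl eu linearB /= mulmxBr v1 veE -!raddfB !mxE eqxx /=.
    by rewrite !mulr1n; ring.
  rewrite rowE -/e mulmxBr mulmx1 -scalemxAr mulmxA eu mul_scalar_mx scalerA.
  (* Both vectors are unit, so [c], the squared norm of [v - e], is [2 (1 - d)]: the reflection
     sends [e] to [e + u = v]. *)
  have -> : 2 / c * (d - 1) = -1.
    by move: c0; rewrite vu => c0; field; move: c0; rewrite mulf_eq0 negb_or => /andP[].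
  by rewrite scaleN1r opprK /u addrC subrK.
Qed.

(** Deflation: conjugating by a reflection whose first row is a unit eigenvector makes the first row
    of [A] diagonal, symmetry clears the first column, and the induction hypothesis treats the
    remaining block. *)
Lemma symmetric_spectral (R : realType) (n : nat) (A : 'M[R]_n) : A^T = A ->
  exists Od : 'M[R]_n * 'rV[R]_n,
    Od.1^T *m Od.1 = 1%:M /\ A = Od.1 *m diag_mx Od.2 *m Od.1^T.
Proof.
elim: n A => [|n IH] A As.
  by exists (1%:M, 0); split; apply/matrixP => -[].
have [a /eigenvalueP[w wA w0]] := symmetric_eigenvalue As.
pose c := (w *m w^T) 0 0.
have c0 : 0 < c.
  rewrite lt_def norm_row_eq0 w0 /= /c mxE sumr_ge0 // => i _.
  by rewrite mxE -expr2 sqr_ge0.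
pose v := (Num.sqrt c)^-1 *: w.
have vA : v *m A = a *: v by rewrite -scalemxAl wA !scalerA mulrC.
have v1 : v *m v^T = 1%:M.
  rewrite linearZ /= -scalemxAl -scalemxAr scalerA [w *m _]mx11_scalar -/c.
  rewrite -invfM -expr2 sqr_sqrtr ?ltW// scale_scalar_mx mulVf //.
  by rewrite gt_eqF.
have [Q [Qt QQ Qv]] := orthogonal_first_row v1.
pose B : 'M[R]_(1 + n) := Q *m A *m Q.
have BQ : B = Q *m A *m Q by [].
clearbody B.
have Bt : B^T = B by rewrite BQ !trmx_mul Qt As mulmxA.
have Brow : row ord0 B = a *: delta_mx ord0 ord0.
  rewrite BQ !row_mul Qv vA -scalemxAl -Qv -row_mul QQ row1; done.
have Bur : ursubmx B = 0.
  apply/rowP => j; have /rowP/(_ (rshift 1 j)) := Brow.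
  by rewrite !mxE /= mulr0 => H; rewrite -[RHS]H; congr (B _ _); apply/val_inj.
have Bul : ulsubmx B = a%:M.
  apply/matrixP => i j; have /rowP/(_ (lshift n j)) := Brow.
  rewrite !ord1 !mxE /= mulr1 => H; rewrite mulr1n -[RHS]H.
  by congr (B _ _); apply/val_inj.
have Bdl : dlsubmx B = 0.
  by rewrite -[B]Bt -trmx_ursub Bur trmx0.
have /IH [[V D] /= [VV BE]] : (drsubmx B)^T = drsubmx B.
  by rewrite trmx_drsub Bt.
pose O1 : 'M[R]_(1 + n) := block_mx 1%:M 0 0 V.
have BE1 : B = O1 *m diag_mx (row_mx a%:M D) *m O1^T.
  rewrite -[LHS](@submxK _ 1 n 1 n) Bur Bul Bdl BE.
  rewrite tr_block_mx !trmx0 trmx1 diag_mx_row !mulmx_block.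
  rewrite !(mulmx0, mul0mx, addr0, add0r, mulmx1, mul1mx).
  by congr block_mx; apply/matrixP => i j; rewrite !ord1 !mxE !eqxx /= !mulr1n.
have O1O1 : O1^T *m O1 = 1%:M.
  rewrite tr_block_mx !trmx0 trmx1 mulmx_block.
  by rewrite !(mulmx0, mul0mx, addr0, add0r, mulmx1, mul1mx) VV -scalar_mx_block.
exists (Q *m O1, row_mx a%:M D); split => /=.
  by rewrite trmx_mul Qt mulmxA -(mulmxA O1^T) QQ mulmx1.
have -> : Q *m O1 *m diag_mx (row_mx a%:M D) *m (Q *m O1)^T = Q *m B *m Q.
  by rewrite BE1 trmx_mul Qt !mulmxA.
by rewrite BQ !mulmxA QQ mul1mx -mulmxA QQ mulmx1.
Qed.

(** * Inverse square root of a Gram matrix *)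

(** Functional calculus in the eigenbasis [V]: with the lemmas below, identities between functions
    of the Gram matrix reduce to scalar identities in its eigenvalues. *)
Definition conj_diag (R : realType) (n : nat) (V : 'M[R]_n) (f : 'I_n -> R) : 'M[R]_n :=
  V *m diag_mx (\row_i f i) *m V^T.

Lemma conj_diagE (R : realType) (n : nat) (V : 'M[R]_n) (f : 'I_n -> R) i j :
  conj_diag V f i j = \sum_m V i m * f m * V j m.
Proof.
rewrite /conj_diag mxE; apply: eq_bigr => m _.
rewrite mxE (bigD1 m) //= big1 ?addr0 => [|k km]; rewrite !mxE ?eqxx ?mulr1n //.
by rewrite (negbTE km) mulr0n mulr0.
Qed.

Lemma conj_diagM (R : realType) (n : nat) (V : 'M[R]_n) (f g : 'I_n -> R) :
  V^T *m V = 1%:M ->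
  conj_diag V f *m conj_diag V g = conj_diag V (fun i => f i * g i).
Proof.
move=> VV; rewrite /conj_diag -!mulmxA; congr (_ *m _).
rewrite !mulmxA -(mulmxA _ V^T V) VV mulmx1; congr (_ *m _).
by rewrite mulmx_diag; congr diag_mx; apply/rowP => i; rewrite !mxE.
Qed.

Lemma conj_diagT (R : realType) (n : nat) (V : 'M[R]_n) (f : 'I_n -> R) :
  (conj_diag V f)^T = conj_diag V f.
Proof. by rewrite /conj_diag !trmx_mul trmxK tr_diag_mx mulmxA. Qed.

Lemma conj_diagZ (R : realType) (n : nat) (V : 'M[R]_n) (f : 'I_n -> R) a :
  a *: conj_diag V f = conj_diag V (fun i => a * f i).
Proof.
apply/matrixP => i j; rewrite [LHS]mxE !conj_diagE mulr_sumr.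
by apply: eq_bigr => m _; ring.
Qed.

Lemma conj_diagB (R : realType) (n : nat) (V : 'M[R]_n) (f g : 'I_n -> R) :
  conj_diag V f - conj_diag V g = conj_diag V (fun i => f i - g i).
Proof.
apply/matrixP => i j; rewrite [LHS]mxE [X in _ + X]mxE !conj_diagE -sumrN -big_split /=.
by apply: eq_bigr => m _; ring.
Qed.

Lemma conj_diag1 (R : realType) (n : nat) (V : 'M[R]_n) :
  V^T *m V = 1%:M -> conj_diag V (fun=> 1) = 1%:M.
Proof.
move=> /mulmx1C VV; rewrite /conj_diag -[RHS]VV; congr (_ *m _).
rewrite -[RHS]mulmx1; congr (_ *m _).
by apply/matrixP => i j; rewrite !mxE.
Qed.

Lemma spec_decompE (R : realType) (n : nat) (M : 'M[R]_n) Od :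
  spec_decomp M Od -> M = conj_diag Od.1 (Od.2 0).
Proof.
move=> [_ [_ ->]]; rewrite /conj_diag; congr (_ *m _ *m _).
by congr diag_mx; apply/rowP => i; rewrite mxE.
Qed.

Lemma spec_decomp_det (R : realType) (n : nat) (M : 'M[R]_n) Od :
  spec_decomp M Od -> \det M != 0.
Proof.
move=> [VV [d0 ->]]; rewrite !det_mulmx mulrAC -det_mulmx (mulmx1C VV) det1.
by rewrite mul1r det_diag prodf_seq_neq0; apply/allP => i _; rewrite gt_eqF.
Qed.

(** The eigenvalues are the squared norms of the columns of [X V], so a nonzero determinant makes
    them positive. This trades the existential condition in [invsqrt] for a measurable one. *)
Lemma gram_spec_decomp (R : realType) (n p : nat) (X : 'M[R]_(n, p)) :
  \det (X^T *m X) != 0 -> exists Od, spec_decomp (X^T *m X) Od.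
Proof.
move=> X0; have [|[V D] /= [VV XE]] := @symmetric_spectral R p (X^T *m X).
  by rewrite trmx_mul trmxK.
exists (V, D); split => //; split => //= i.
have DE : (X *m V)^T *m (X *m V) = diag_mx D.
  rewrite trmx_mul -mulmxA (mulmxA X^T) XE !mulmxA VV mul1mx.
  by rewrite -mulmxA VV mulmx1.
have Di : D 0 i = \sum_k ((X *m V) k i) ^+ 2.
  have /matrixP/(_ i i) := DE; rewrite !mxE eqxx mulr1n => <-.
  by apply: eq_bigr => k _; rewrite !mxE expr2.
rewrite lt_def Di sumr_ge0 ?andbT => [|k _]; last exact: sqr_ge0.
rewrite -Di; move: X0; rewrite XE !det_mulmx det_diag !mulf_eq0 !negb_or.
move=> /andP[/andP[_ D0] _].
by apply: contraNneq D0 => Di0; rewrite (bigD1 i) //= Di0 mul0r.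
Qed.

Lemma invsqrtP (R : realType) (n p : nat) (X : 'M[R]_(n, p)) :
  \det (X^T *m X) != 0 -> exists Od, spec_decomp (X^T *m X) Od /\
    invsqrt (X^T *m X) = conj_diag Od.1 (fun i => (Num.sqrt (Od.2 0 i))^-1).
Proof.
move=> /gram_spec_decomp ex; rewrite /invsqrt.
by case: pselect => // e; exists (projT1 (cid e)); split => //; exact: projT2 (cid e).
Qed.

Lemma invsqrt_singular (R : realType) (n : nat) (M : 'M[R]_n) :
  \det M = 0 -> invsqrt M = 0.
Proof.
move=> M0; rewrite /invsqrt; case: pselect => // e.
by have [Od /spec_decomp_det] := e; rewrite M0 eqxx.
Qed.

Section gram_invsqrt.
Variables (R : realType) (n p : nat) (X : 'M[R]_(n, p)).
Hypothesis X0 : \det (X^T *m X) != 0.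
Local Notation M := (X^T *m X).
Local Notation K := (invsqrt (X^T *m X)).

Lemma invsqrt_trmx : K^T = K.
Proof. by have [Od [_ ->]] := invsqrtP X0; rewrite conj_diagT. Qed.

Lemma invsqrt_whiten : K *m M *m K = 1%:M.
Proof.
have [Od [Ods ->]] := invsqrtP X0; rewrite {1}(spec_decompE Ods).
have [VV [d0 _]] := Ods; rewrite !conj_diagM // -(conj_diag1 VV).
congr conj_diag; apply/funext => i.
rewrite -{2}(sqr_sqrtr (ltW (d0 i))).
by field; rewrite gt_eqF // sqrtr_gt0.
Qed.

Lemma invsqrt_sqrt : (K *m M) *m (K *m M)^T = M.
Proof.
have [Od [Ods ->]] := invsqrtP X0; rewrite (spec_decompE Ods).
have [VV [d0 _]] := Ods; rewrite conj_diagM // conj_diagT conj_diagM //.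
congr conj_diag; apply/funext => i.
rewrite -{2 4 5}(sqr_sqrtr (ltW (d0 i))).
by field; rewrite gt_eqF // sqrtr_gt0.
Qed.

(** The rows of the whitening matrix are orthonormal; this is why each noise coordinate of [z] is
    standard normal given the design. *)
Lemma whitened_row_norm (j : 'I_p) : \sum_i ((K *m X^T) j i) ^+ 2 = 1.
Proof.
have : (K *m X^T) *m (K *m X^T)^T = 1%:M.
  by rewrite trmx_mul trmxK invsqrt_trmx -[RHS]invsqrt_whiten !mulmxA.
move=> /matrixP/(_ j j); rewrite [RHS]mxE eqxx mulr1n => <-.
by rewrite mxE; apply: eq_bigr => i _; rewrite [X in _ = _ * X]mxE expr2.
Qed.

(** [K *m M] is the symmetric square root of [M]. This identity lets the sign average depend on the
    design only through [M j j]. *)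
Lemma sqrt_gram_row_norm (j : 'I_p) : \sum_i ((K *m M) j i) ^+ 2 = M j j.
Proof.
have /matrixP/(_ j j) := invsqrt_sqrt => {1}<-.
by rewrite mxE; apply: eq_bigr => i _; rewrite [X in _ = _ * X]mxE expr2.
Qed.

End gram_invsqrt.

(* Newton's iteration [y <- y (3 - x y ^ 2) / 2] for [1 / sqrt x] is polynomial in [x]:
   it exhibits [invsqrt], defined by choice of eigenvectors, as a pointwise limit of
   measurable functions. *)
Fixpoint newton (R : realType) (x : R) k : R :=
  if k is k'.+1 then
    let y := newton x k' in 2^-1 * (3 * y - x * (y * (y * y))) else 1.

Fixpoint newton_mx (R : realType) n (N : 'M[R]_n) k : 'M[R]_n :=
  if k is k'.+1 then
    let Y := newton_mx N k' in 2^-1 *: (3 *: Y - N *m (Y *m (Y *m Y))) else 1%:M.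

Lemma newton_mx_diag (R : realType) (n : nat) (V : 'M[R]_n) (f : 'I_n -> R) k :
  V^T *m V = 1%:M ->
  newton_mx (conj_diag V f) k = conj_diag V (fun i => newton (f i) k).
Proof.
move=> VV; elim: k => [|k IH]; first by rewrite /= conj_diag1.
by rewrite /= IH !conj_diagM // !conj_diagZ conj_diagB conj_diagZ.
Qed.

(** For [x <= 1] the start value 1 lies below the target. The invariant [1 <= y], [x y ^ 2 <= 1]
    makes the sequence nondecreasing and bounded by [x^-1], and a limit [l >= 1] fixed by the
    iteration satisfies [x l ^ 2 = 1]. *)
Lemma newton_cvg (R : realType) (x : R) : 0 < x <= 1 ->
  newton x @ \oo --> (Num.sqrt x)^-1.
Proof.
move=> /andP[x0 x1].
have inv k : 1 <= newton x k /\ x * newton x k ^+ 2 <= 1.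
  elim: k => [|k /= [y1 xy]]; first by rewrite /= expr1n mulr1.
  set y := newton x k in y1 xy *; set u := x * y ^+ 2 in xy.
  have u0 : 0 <= u by rewrite mulr_ge0 ?sqr_ge0 // ltW.
  have -> : 3 * y - x * (y * (y * y)) = y * (3 - u) by rewrite /u; ring.
  split; first by nra.
  have -> : x * (2^-1 * (y * (3 - u))) ^+ 2 = u * (3 - u) ^+ 2 / 4.
    by rewrite /u; field.
  rewrite -subr_ge0.
  have -> : 1 - u * (3 - u) ^+ 2 / 4 = (1 - u) ^+ 2 * (4 - u) / 4 by field.
  by rewrite !mulr_ge0 ?sqr_ge0 ?subr_ge0 ?invr_ge0 // (le_trans xy) // ler1n.
have nd : nondecreasing_seq (newton x).
  apply/nondecreasing_seqP => k /=; have [y1 xy] := inv k.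
  set y := newton x k in y1 xy *.
  have -> : 3 * y - x * (y * (y * y)) = y * (3 - x * y ^+ 2) by ring.
  by nra.
have /(nondecreasing_is_cvgn nd) cv : has_ubound (range (newton x)).
  exists x^-1 => _ [k _ <-]; have [y1 xy] := inv k.
  rewrite -(ler_pM2l x0) divff ?gt_eqF //.
  by apply: le_trans xy; rewrite ler_pM2l // expr2 ler_peMl // (le_trans _ y1).
set l := limn (newton x) in cv *.
have l1 : 1 <= l by apply: le_trans (nondecreasing_cvgn_le nd cv 0%N).
have lE : l = 2^-1 * (3 * l - x * (l * (l * l))).
  apply/cvg_lim => //.
  rewrite -cvg_shiftS /=; apply: cvgMr.
  by apply: cvgB; [exact: cvgMr|apply: cvgMr; apply: cvgM => //; exact: cvgM].
have xl : x * l ^+ 2 = 1.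
  have : l * (1 - x * l ^+ 2) = 0 by rewrite expr2; lra.
  move=> /eqP; rewrite mulf_eq0 gt_eqF /= ?(lt_le_trans _ l1) //.
  by rewrite subr_eq0 => /eqP.
suff <- : l = (Num.sqrt x)^-1 by [].
have l0 : 0 < l by exact: lt_le_trans l1.
have -> : x = l^-1 ^+ 2.
  have l2 : l ^+ 2 != 0 by rewrite expf_neq0 // gt_eqF.
  by rewrite exprVn; apply: (mulIf l2); rewrite xl mulVf.
by rewrite sqrtr_sqr ger0_norm ?invrK // invr_ge0 ltW.
Qed.

(** * Measurability of the inverse square root *)

Section measurable_matrices.
Context (d : measure_display) (T : measurableType d) (R : realType).

Definition measurable_mx (m n : nat) (A : T -> 'M[R]_(m, n)) :=
  forall i j, measurable_fun setT (fun w => A w i j).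

Lemma measurable_mx_mul m n k (A : T -> 'M[R]_(m, n)) (B : T -> 'M[R]_(n, k)) :
  measurable_mx A -> measurable_mx B -> measurable_mx (fun w => A w *m B w).
Proof.
move=> mA mB i j; under eq_fun do rewrite mxE.
by apply: measurable_sum => l; exact: measurable_funM.
Qed.

Lemma measurable_mx_tr m n (A : T -> 'M[R]_(m, n)) :
  measurable_mx A -> measurable_mx (fun w => (A w)^T).
Proof. by move=> mA i j; under eq_fun do rewrite mxE; exact: mA. Qed.

Lemma measurable_mx_add m n (A B : T -> 'M[R]_(m, n)) :
  measurable_mx A -> measurable_mx B -> measurable_mx (fun w => A w + B w).
Proof.
by move=> mA mB i j; under eq_fun do rewrite mxE; exact: measurable_funD.
Qed.

Lemma measurable_mx_scale m n (f : T -> R) (A : T -> 'M[R]_(m, n)) :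
  measurable_fun setT f -> measurable_mx A ->
  measurable_mx (fun w => f w *: A w).
Proof.
by move=> mf mA i j; under eq_fun do rewrite mxE; exact: measurable_funM.
Qed.

Lemma measurable_mx_cst m n (A : 'M[R]_(m, n)) : measurable_mx (fun=> A).
Proof. by move=> i j; exact: measurable_cst. Qed.

Lemma measurable_newton_mx n (N : T -> 'M[R]_n) k :
  measurable_mx N -> measurable_mx (fun w => newton_mx (N w) k).
Proof.
move=> mN; elim: k => [|k IH] /=; first exact: measurable_mx_cst.
apply: measurable_mx_scale => //; apply: measurable_mx_add.
  exact: measurable_mx_scale.
under eq_fun do rewrite -scaleN1r.
apply: measurable_mx_scale => //.
by apply: measurable_mx_mul => //; apply: measurable_mx_mul => //; exact: measurable_mx_mul.
Qed.

Lemma measurable_det n (N : T -> 'M[R]_n) :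
  measurable_mx N -> measurable_fun setT (fun w => \det (N w)).
Proof.
move=> mN; rewrite /determinant; apply: measurable_sum => s.
by apply: measurable_funM => //; apply: measurable_prod => i _; exact: mN.
Qed.

Lemma measurable_det_neq0 n (N : T -> 'M[R]_n) :
  measurable_mx N -> measurable [set w | \det (N w) != 0].
Proof.
move=> mN; have -> : [set w | \det (N w) != 0] =
    setT `&` (fun w => \det (N w)) @^-1` (~` [set 0]).
  by apply/seteqP; split => w /=; [move=> /eqP|move=> [_ /eqP]].
by apply: measurable_det => //; exact: measurableC.
Qed.

Lemma measurable_invsqrt (m n : nat) (X : T -> 'M[R]_(m, n)) :
  measurable_mx X -> measurable_mx (fun w => invsqrt ((X w)^T *m X w)).
Proof.
move=> mX i j.
have mM : measurable_mx (fun w => (X w)^T *m X w).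
  by apply: measurable_mx_mul => //; exact: measurable_mx_tr.
(* Multiplying by [g w * g w], the inverse trace, puts all eigenvalues in [(0, 1]], where Newton's
   iteration converges; the outer factor [g w] undoes the scaling. *)
pose g w := powR (\tr ((X w)^T *m X w)) (- 2^-1).
have mg : measurable_fun setT g.
  apply: (measurableT_comp (measurable_powR _)).
  by rewrite /mxtrace; apply: measurable_sum => l; exact: mM.
pose h k w := if \det ((X w)^T *m X w) != 0 then
  g w * newton_mx ((g w * g w) *: ((X w)^T *m X w)) k i j else 0.
apply: (@measurable_fun_cvg _ _ _ _ h) => [k|w _].
  apply: measurable_fun_ifT => //.
    have := measurable_det_neq0 mM; rewrite -[X in measurable X]setTI => mD.
    apply: (@measurable_fun_bool _ _ _ _ true) => //.
  apply: measurable_funM => //; apply: measurable_newton_mx.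
  by apply: measurable_mx_scale => //; exact: measurable_funM.
rewrite /h; have [D0|D0] /= := eqVneq (\det ((X w)^T *m X w)) 0.
  by rewrite invsqrt_singular // mxE; exact: cvg_cst.
have [Od [Ods ->]] := invsqrtP D0; have ME := spec_decompE Ods.
have [VV [d0 _]] := Ods.
have trM : \tr ((X w)^T *m X w) = \sum_l Od.2 0 l.
  rewrite ME /conj_diag mxtrace_mulC mulmxA VV mul1mx mxtrace_diag.
  by apply: eq_bigr => l _; rewrite mxE.
have NE a : a *: ((X w)^T *m X w) = conj_diag Od.1 (fun l => a * Od.2 0 l).
  by rewrite -conj_diagZ -ME.
rewrite conj_diagE.
rewrite [X in X @ _ --> _](_ : _ = fun k => \sum_l
    Od.1 i l * (g w * newton (g w * g w * Od.2 0 l) k) * Od.1 j l); last first.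
  apply/funext => k; rewrite NE newton_mx_diag // conj_diagE.
  by rewrite mulr_sumr; apply: eq_bigr => l _; ring.
apply: cvg_big => [|l _]; first exact: add_continuous.
 apply: cvgMl; apply: cvgMr.
have c0 : 0 < \tr ((X w)^T *m X w).
  rewrite trM (bigD1 l) //= ltr_pwDl //; apply: sumr_ge0 => q _; exact: ltW.
have g0 : 0 < g w by exact: powR_gt0.
have gg : g w * g w = (\tr ((X w)^T *m X w))^-1.
  rewrite /g -powRD; last by rewrite (gt_eqF c0) implybT.
  have -> : - 2^-1 + - 2^-1 = -1 :> R by field.
  by rewrite powR_inv1 // ltW.
have -> : (Num.sqrt (Od.2 0 l))^-1 = g w * (Num.sqrt (g w * g w * Od.2 0 l))^-1.
  rewrite sqrtrM ?mulr_ge0 ?ltW // -expr2 sqrtr_sqr ger0_norm ?ltW //.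
  by field; rewrite !gt_eqF // sqrtr_gt0.
apply: cvgMr; apply: newton_cvg; rewrite mulr_gt0 ?mulr_gt0 //=.
rewrite gg mulrC ler_pdivrMr // mul1r trM (bigD1 l) //= lerDl.
by apply: sumr_ge0 => q _; exact: ltW.
Qed.

End measurable_matrices.

(** * Gaussian mixtures *)

Lemma integral_normal_prob (R : realType) (f : R -> \bar R) :
  (forall x, (0 <= f x)%E) -> measurable_fun setT f ->
  (\int[normal_prob 0 1]_x f x =
   \int[lebesgue_measure]_x (f x * (normal_pdf (0 : R) 1 x)%:E))%E.
Proof.
move=> f0 mf; have dom := @normal_prob_dominates R 0 1.
rewrite -(Radon_Nikodym_SigmaFinite.change_of_variables dom f0) //.
have mpdf : measurable_fun setT (fun x : R => (normal_pdf 0 1 x)%:E).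
  by apply/measurable_EFinP; exact: measurable_normal_pdf.
have mRN := measurable_int _ (Radon_Nikodym_SigmaFinite.f_integrable dom).
apply: ae_eq_integral => //.
- exact: emeasurable_funM.
- exact: emeasurable_funM.
(* The Radon-Nikodym derivative agrees almost everywhere with the density because both have the same
   integral over every measurable set. *)
- apply: ae_eqe_mul2l; apply: integral_ae_eq => //.
    exact: Radon_Nikodym_SigmaFinite.f_integrable.
  by move=> E _ mE; rewrite -Radon_Nikodym_SigmaFinite.f_integral.
Qed.

(** Completing the square turns the tilted standard density into the density with mean [c]. *)
Lemma normal_mgf (R : realType) (c : R) :
  (\int[normal_prob 0 1]_x (expR (c * x))%:E = (expR (c ^+ 2 / 2))%:E)%E.
Proof.
rewrite integral_normal_prob //; last first.
  by apply/measurable_EFinP; apply: measurableT_comp => //; exact: measurable_funM.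
transitivity (\int[lebesgue_measure]_x
   ((expR (c ^+ 2 / 2))%:E * (normal_pdf c 1 x)%:E))%E.
  apply: eq_integral => x _; rewrite -!EFinM !normal_pdfE ?oner_neq0 //.
  congr EFin; rewrite mulrCA [RHS]mulrCA; congr *%R.
  by rewrite /normal_fun -!expRD expr1n; congr expR; field.
rewrite ge0_integralZl //.
- by rewrite integral_normal_pdf mule1.
- by apply/measurable_EFinP; exact: measurable_normal_pdf.
- by move=> x _; rewrite lee_fin normal_pdf_ge0.
Qed.

Section gaussian_peeling.
Context (d : measure_display) (Omega : measurableType d) (R : realType).
Variables (P : probability Omega R) (G : set (set Omega)) (U : Omega -> R).
Hypotheses (GI : setI_closed G) (GT : G setT) (Gm : G `<=` measurable).
Hypothesis mU : measurable_fun setT U.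
Hypothesis GU : forall A B, G A -> measurable B ->
  (P (A `&` U @^-1` B) = normal_prob 0 1 B * P A)%E.

Let T : measurableType _ := g_sigma_algebraType G.
(** The identity onto the coarser sigma-algebra generated by [G]; its law is the restriction of [P]
    to that sigma-algebra. *)
Let idT : Omega -> T := id.

Let measurable_idT : measurable_fun setT idT.
Proof.
move=> _ B mB; rewrite setTI; move: B mB.
by apply: smallest_sub => //; exact: sigma_algebra_measurable.
Qed.

Let mU_pre B : measurable B -> measurable (U @^-1` B).
Proof. by move=> mB; rewrite -[X in measurable X]setTI; exact: mU. Qed.

(** For fixed [B] both sides are finite measures in [A] that agree on the pi-system [G], hence on
    the sigma-algebra it generates. *)
Let indep (A : set Omega) (B : set R) : <<s G >> A -> measurable B ->
  P (A `&` U @^-1` B) = (normal_prob 0 1 B * P A)%E.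
Proof.
move=> GA mB.
pose c : {nonneg R} := NngNum (fine_ge0 (measure_ge0 (normal_prob (0 : R) 1) B)).
have cE : c%:num%:E = normal_prob 0 1 B by rewrite fineK // fin_num_measure.
have -> : (normal_prob 0 1 B * P A)%E = mscale c P A by rewrite -cE.
rewrite -[LHS]/(mrestr P (mU_pre mB) A).
apply: (g_sigma_algebra_measure_unique G Gm (fun=> setT)) => //.
- by rewrite bigcup_const.
- by move=> C GC; rewrite /= /mrestr GU // -cE.
- by move=> k; rewrite /= /mrestr setTI (le_lt_trans (probability_le1 _ _)) ?ltry //; exact: mU_pre.
Qed.

Let idT_mixin := isMeasurableFun.Build _ _ _ _ idT measurable_idT.
Let idT_mfun : {mfun Omega >-> T} := HB.pack idT idT_mixin.

Let pairT (w : Omega) : measurableTypeR R * T := (U w, idT w).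
Let measurable_pairT : measurable_fun setT pairT.
Proof. exact: measurable_fun_pair. Qed.
Let pairT_mixin := isMeasurableFun.Build _ _ _ _ pairT measurable_pairT.
Let pairT_mfun : {mfun Omega >-> (measurableTypeR R * T)%type} := HB.pack pairT pairT_mixin.

Let joint_law (S : set (measurableTypeR R * T)) : measurable S ->
  (normal_prob (0 : R) 1 \x distribution P idT_mfun)%E S =
  distribution P pairT_mfun S.
Proof.
move=> mS.
apply: (@product_measure_unique _ _ _ _ R (normal_prob 0 1)
  (distribution P idT_mfun) (distribution P pairT_mfun)) => // B A mB mA.
rewrite /distribution /pushforward /= -[in RHS]indep //.
by congr (P _); rewrite setIC.
Qed.

(** Independence makes the joint law of [U] and the sigma-algebra of [G] a product, so Tonelli's
    theorem integrates [U] out with [a] and [V] frozen. *)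
Lemma gaussian_peel (a V : g_sigma_algebraType G -> R) :
  measurable_fun setT a -> measurable_fun setT V -> (forall w, 0 <= V w) ->
  (\int[P]_w (V w * expR (a w * U w))%:E =
   \int[P]_w (V w * expR (a w ^+ 2 / 2))%:E)%E.
Proof.
move=> ma mV V0.
pose f (z : measurableTypeR R * T) : \bar R := (V z.2 * expR (a z.2 * z.1))%:E.
have mf : measurable_fun setT f.
  apply/measurable_EFinP; apply: measurable_funM.
    exact: measurableT_comp.
  apply: measurableT_comp => //; apply: measurable_funM => //.
  exact: measurableT_comp.
have f0 z : (0 <= f z)%E by rewrite lee_fin mulr_ge0 // expR_ge0.
pose g (w : T) : \bar R := (V w * expR (a w ^+ 2 / 2))%:E.
have mg : measurable_fun setT g.
  apply/measurable_EFinP; apply: measurable_funM => //.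
  apply: measurableT_comp => //; apply: measurable_funM => //.
  exact: measurable_funX.
have g0 w : (0 <= g w)%E by rewrite lee_fin mulr_ge0 // expR_ge0.
transitivity (\int[distribution P pairT_mfun]_z f z)%E.
  by rewrite ge0_integral_distribution.
transitivity (\int[distribution P idT_mfun]_w g w)%E; last first.
  by rewrite ge0_integral_distribution.
rewrite -(eq_measure_integral _ (fun S mS _ => joint_law mS)).
rewrite fubini_tonelli2 //; apply: eq_integral => w _.
rewrite /fubini_G /f /g /=; under eq_integral do rewrite EFinM.
rewrite ge0_integralZl ?lee_fin // ?normal_mgf //.
by apply/measurable_EFinP; apply: measurableT_comp => //; exact: measurable_funM.
Qed.

End gaussian_peeling.

(* Borel functions of a matrix; matrix types carry no sigma-algebra here. *)
Definition mx_measurable (R : realType) (m n : nat) (phi : 'M[R]_(m, n) -> R) :=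
  forall (d : measure_display) (T : measurableType d) (Y : T -> 'M[R]_(m, n)),
    measurable_mx Y -> measurable_fun setT (fun w => phi (Y w)).

Section gaussian_mixture.
Context (d : measure_display) (Omega : measurableType d) (R : realType).
Variables (P : probability Omega R) (n p : nat).
Variables (X : Omega -> 'M[R]_(n, p)) (eps : Omega -> 'cV[R]_n).
Hypothesis Xeps : gauss_indep P X eps.

Let cylinder (B : 'I_n -> set R) (C : 'I_n -> 'I_p -> set R) : set Omega :=
  [set w | (forall i, eps w i 0 \in B i) /\ (forall k l, X w k l \in C k l)].

(* A pi-system generating the events determined by [X] and the first [k] noises. *)
Let past k : set (set Omega) := [set S | exists B C,
  [/\ forall i, measurable (B i), forall k l, measurable (C k l),
      forall i : 'I_n, (k <= i)%N -> B i = setT & S = cylinder B C]].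

Let cylinderT : cylinder (fun=> setT) (fun _ _ => setT) = setT.
Proof. by apply/seteqP; split => // w _; split => *; rewrite inE. Qed.

Let past_T k : past k setT.
Proof. by exists (fun=> setT), (fun _ _ => setT); split => //; rewrite cylinderT. Qed.

Let past_setI k : setI_closed (past k).
Proof.
move=> _ _ [B [C [mB mC Bk ->]]] [B' [C' [mB' mC' Bk' ->]]].
exists (fun i => B i `&` B' i), (fun k l => C k l `&` C' k l); split.
- by move=> i; exact: measurableI.
- by move=> i j; exact: measurableI.
- by move=> i ki; rewrite Bk // Bk' // setTI.
- apply/seteqP; split => w.
    move=> [[H1 H2] [H3 H4]]; split=> [i|i j]; apply/mem_set; split; exact/set_mem.
  move=> [H1 H2].
  have H1' i := set_mem (H1 i); have H2' i j := set_mem (H2 i j).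
  split; split.
  - by move=> i; apply/mem_set; have [] := H1' i.
  - by move=> i j; apply/mem_set; have [] := H2' i j.
  - by move=> i; apply/mem_set; have [] := H1' i.
  - by move=> i j; apply/mem_set; have [] := H2' i j.
Qed.

Let past_measurable k : past k `<=` measurable.
Proof.
have [meps [mX _]] := Xeps.
move=> _ [B [C [mB mC _ ->]]].
have -> : cylinder B C = (\bigcap_(i in setT) (fun w => eps w i 0) @^-1` B i) `&`
    \bigcap_(k in setT) \bigcap_(l in setT) (fun w => X w k l) @^-1` C k l.
  apply/seteqP; split => w.
    move=> [H1 H2]; split; first by move=> i _; exact/set_mem/H1.
    by move=> i _ j _; exact/set_mem/H2.
  move=> [H1 H2]; split; first by move=> i; apply/mem_set/H1.
  by move=> i j; apply/mem_set/H2.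
apply: measurableI; apply: fin_bigcap_measurable => [|i _]; try exact: finite_finset.
  by rewrite -[X in measurable X]setTI; apply: meps => //; exact: mB.
apply: fin_bigcap_measurable => [|j _]; first exact: finite_finset.
by rewrite -[X in measurable X]setTI; apply: mX => //; exact: mC.
Qed.

(** Events of [past k] leave the noise [k] unconstrained, so adding a constraint on it gives a
    cylinder again, and the product rule acquires exactly one factor. *)
Let past_indep (k : 'I_n) A B : past k A -> measurable B ->
  P (A `&` (fun w => eps w k 0) @^-1` B) = (normal_prob 0 1 B * P A)%E.
Proof.
have [meps [mX PXeps]] := Xeps.
move=> [B' [C [mB' mC Bk ->]]] mB.
pose B2 i := if i == k then B else B' i.
have -> : cylinder B' C `&` (fun w => eps w k 0) @^-1` B = cylinder B2 C.
  apply/seteqP; split => w.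
    move=> [[H1 H2] H3]; split => // i; rewrite /B2.
    by case: eqP => [->|_]; [exact/mem_set|].
  move=> [H1 H2]; split; last by have := H1 k; rewrite /B2 eqxx => /set_mem.
  split => // i; have := H1 i; rewrite /B2; case: eqP => // -> _.
  by rewrite Bk // inE.
rewrite !PXeps //; last by move=> i; rewrite /B2; case: ifP.
rewrite muleA; congr (_ * _)%E; rewrite (bigD1 k) //= [in RHS](bigD1 k) //=.
rewrite Bk // probability_setT mul1e /B2 eqxx; congr (_ * _)%E.
by apply: eq_bigr => i /negbTE ->.
Qed.

Let past_eps k (i : 'I_n) : (i < k)%N ->
  measurable_fun setT (fun w : g_sigma_algebraType (past k) => eps w i 0).
Proof.
move=> ik _ B mB; rewrite setTI; apply: sub_sigma_algebra.
exists (fun j => if j == i then B else setT), (fun _ _ => setT); split => //.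
- by move=> j; case: ifP.
- by move=> j kj; case: eqP => // ji; move: kj; rewrite ji leqNgt ik.
- apply/seteqP; split => w /=.
    by move=> Bw; split => *; rewrite ?inE //; case: eqP => [->|]; rewrite ?inE.
  by move=> [/(_ i) + _]; rewrite eqxx inE.
Qed.

Let past_X k : measurable_mx (fun w : g_sigma_algebraType (past k) => X w).
Proof.
move=> i j _ B mB; rewrite setTI; apply: sub_sigma_algebra.
exists (fun=> setT), (fun i' j' => if (i' == i) && (j' == j) then B else setT); split => //.
- by move=> i' j'; case: ifP.
- apply/seteqP; split => w /=.
    move=> Bw; split => [i'|i' j']; rewrite ?inE //.
    by case: ifP => [/andP[/eqP -> /eqP ->]|]; rewrite ?inE.
  by move=> [_ /(_ i j)]; rewrite !eqxx inE.
Qed.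

(* The noise coordinates are integrated out one at a time, last one first. *)
Lemma gaussian_mixture_mgf (a : 'I_n -> 'M[R]_(n, p) -> R) (V : 'M[R]_(n, p) -> R) :
  (forall i, mx_measurable (a i)) -> mx_measurable V -> (forall M, 0 <= V M) ->
  (\int[P]_w (V (X w) * expR (\sum_i a i (X w) * eps w i 0))%:E =
   \int[P]_w (V (X w) * expR (\sum_i a i (X w) ^+ 2 / 2))%:E)%E.
Proof.
move=> ma mV V0.
(* [S k] keeps the first [k] noises, [Q k] collects the half squares left by those already
   integrated. One use of [gaussian_peel] passes from [k.+1] to [k], since [V'] involves only the
   design and the first [k] noises. *)
pose S k w := \sum_(i < n | (i < k)%N) a i (X w) * eps w i 0.
pose Q k w := \sum_(i < n | (k <= i)%N) a i (X w) ^+ 2 / 2.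
have step k : (k <= n)%N ->
  (\int[P]_w (V (X w) * expR (S k w + Q k w))%:E =
   \int[P]_w (V (X w) * expR (S 0%N w + Q 0%N w))%:E)%E.
  elim: k => [_|k IH kn]; first by [].
  rewrite -(IH (ltnW kn)).
  pose o := Ordinal kn.
  pose V' w := V (X w) * expR (S k w + Q k.+1 w).
  have SE w : S k.+1 w = S k w + a o (X w) * eps w o 0.
    rewrite /S (bigD1 o) /=; last exact: ltnSn.
    rewrite addrC; congr (_ + _); apply: eq_bigl => i.
    by rewrite ltnS [RHS]ltn_neqAle andbC.
  have QE w : Q k w = Q k.+1 w + a o (X w) ^+ 2 / 2.
    rewrite /Q (bigD1 o) /=; last exact: leqnn.
    rewrite addrC; congr (_ + _); apply: eq_bigl => i.
    by rewrite [RHS]ltn_neqAle andbC eq_sym.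
  transitivity (\int[P]_w (V' w * expR (a o (X w) * eps w o 0))%:E)%E.
    apply: eq_integral => w _; congr EFin.
    by rewrite /V' -mulrA -expRD SE; congr (_ * expR _); ring.
  rewrite (@gaussian_peel _ _ _ P (past k) (fun w => eps w o 0)
             (@past_setI k) (past_T k) (@past_measurable k) _ _
             (fun w => a o (X w)) V').
  - apply: eq_integral => w _; congr EFin.
    by rewrite /V' -mulrA -expRD QE; congr (_ * expR _); ring.
  - by case: Xeps.
  - by move=> A B; exact: (@past_indep o).
  - exact: (ma o _ _ _ (@past_X k)).
  - apply: measurable_funM; first exact: (mV _ _ _ (@past_X k)).
    apply: (measurableT_comp (@measurable_expR R)); apply: measurable_funD.
      rewrite [X in measurable_fun _ X](_ : _ = fun w => \sum_(i < n)
        if (i < k)%N then a i (X w) * eps w i 0 else 0); last first.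
        by apply/funext => w; rewrite /S big_mkcond.
      apply: measurable_sum => i; case: (ltnP i k) => ik; last exact: measurable_cst.
      by apply: measurable_funM; [exact: (ma i _ _ _ (@past_X k))|exact: past_eps].
    rewrite [X in measurable_fun _ X](_ : _ = fun w => \sum_(i < n)
      if (k < i)%N then a i (X w) ^+ 2 / 2 else 0); last first.
      by apply/funext => w; rewrite /Q big_mkcond.
    apply: measurable_sum => i; case: (ltnP k i) => ik; last exact: measurable_cst.
    apply: measurable_funM => //; apply: measurable_funX.
    exact: (ma i _ _ _ (@past_X k)).
  - by move=> w; rewrite /V' mulr_ge0 // expR_ge0.
have := step n (leqnn n).
have SnE w : S n w + Q n w = \sum_i a i (X w) * eps w i 0.
  have -> : Q n w = 0 by apply: big_pred0 => i; rewrite leqNgt ltn_ord.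
  by rewrite addr0; apply: eq_bigl => i; rewrite ltn_ord.
have S0E w : S 0%N w + Q 0%N w = \sum_i a i (X w) ^+ 2 / 2.
  have -> : S 0%N w = 0 by exact: big_pred0.
  by rewrite add0r.
under eq_integral do rewrite SnE.
by under [in RHS]eq_integral do rewrite S0E.
Qed.

End gaussian_mixture.

(** * Type I error *)

Lemma measurable_bigmaxr (d : measure_display) (T : measurableType d) (R : realType)
    (I : Type) (s : seq I) (f : I -> T -> R) :
  (forall i, measurable_fun setT (f i)) ->
  measurable_fun setT (fun w => \big[Num.max/0]_(i <- s) f i w).
Proof.
move=> mf; elim: s => [|i s IH].
  by under eq_fun do rewrite big_nil; exact: measurable_cst.
by under eq_fun do rewrite big_cons; exact: measurable_maxr.
Qed.

Lemma measurable_mxP (d : measure_display) (T : measurableType d) (R : realType)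
    (m n : nat) (phi : 'M[R]_(m, n) -> R) (Y : T -> 'M[R]_(m, n)) :
  mx_measurable phi -> measurable_mx Y -> measurable_fun setT (fun w => phi (Y w)).
Proof. by move=> mphi; exact: mphi. Qed.

Section design_functions.
Variables (R : realType) (n p : nat).

Lemma mx_measurable_whitening j i :
  mx_measurable (fun M : 'M[R]_(n, p) => (invsqrt (M^T *m M) *m M^T) j i).
Proof.
move=> d T Y mY.
apply: (measurable_mx_mul (A := fun w => invsqrt ((Y w)^T *m Y w))
  (B := fun w => (Y w)^T)); first exact: measurable_invsqrt.
exact: measurable_mx_tr.
Qed.

Lemma mx_measurable_signal (b : 'cV[R]_p) j :
  mx_measurable (fun M : 'M[R]_(n, p) => (invsqrt (M^T *m M) *m (M^T *m M) *m b) j 0).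
Proof.
move=> d T Y mY.
apply: (measurable_mx_mul (B := fun=> b)); last exact: measurable_mx_cst.
apply: (measurable_mx_mul (A := fun w => invsqrt ((Y w)^T *m Y w))).
  exact: measurable_invsqrt.
apply: (measurable_mx_mul (A := fun w => (Y w)^T)) => //.
exact: measurable_mx_tr.
Qed.

Lemma mx_measurable_gram j i :
  mx_measurable (fun M : 'M[R]_(n, p) => (M^T *m M) j i).
Proof.
move=> d T Y mY; apply: (measurable_mx_mul (A := fun w => (Y w)^T)) => //.
exact: measurable_mx_tr.
Qed.

Lemma zvecE (M : 'M[R]_(n, p)) (b : 'cV[R]_p) (e : 'cV[R]_n) j :
  zvec M (M *m b + e) j 0 = (invsqrt (M^T *m M) *m (M^T *m M) *m b) j 0 +
    \sum_i (invsqrt (M^T *m M) *m M^T) j i * e i 0.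
Proof.
by rewrite /zvec !mulmxDr !mulmxA mxE; congr (_ + _); rewrite mxE.
Qed.

Lemma maxabs_gtP (z : 'cV[R]_p) (t : R) : 0 <= t ->
  t < maxabs z -> exists j, t < `|z j 0|.
Proof.
move=> t0 tz; apply: contrapT => /forallNP tn; move: tz.
rewrite ltNge => /negP; apply; rewrite /maxabs.
by apply: bigmax_le => // j _; rewrite leNgt; apply/negP; exact: tn.
Qed.

Lemma le_maxabs (z : 'cV[R]_p) j : `|z j 0| <= maxabs z.
Proof. by rewrite /maxabs; exact: le_bigmax. Qed.

End design_functions.

Section tests.
Context (d : measure_display) (Omega : measurableType d) (R : realType).
Variables (P : probability Omega R) (n p : nat).
Variables (X : Omega -> 'M[R]_(n, p)) (eps : Omega -> 'cV[R]_n).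
Hypothesis Xeps : gauss_indep P X eps.

Definition rejection t b : set Omega :=
  [set w | t < maxabs (zvec (X w) (X w *m b + eps w))].

Lemma measurable_design : measurable_mx X.
Proof. by have [_ []] := Xeps. Qed.

Lemma measurable_zvec b j :
  measurable_fun setT (fun w => zvec (X w) (X w *m b + eps w) j 0).
Proof.
have [meps _] := Xeps; have mX := measurable_design.
under eq_fun do rewrite zvecE.
apply: measurable_funD; first exact: (measurable_mxP (mx_measurable_signal b j) mX).
apply: measurable_sum => i; apply: measurable_funM => //.
exact: (measurable_mxP (mx_measurable_whitening j i) mX).
Qed.

Lemma measurable_rejection t b : measurable (rejection t b).
Proof.
have mm : measurable_fun setT (fun w => maxabs (zvec (X w) (X w *m b + eps w))).
  apply: measurable_bigmaxr => j; apply: measurableT_comp => //.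
  exact: measurable_zvec.
rewrite -[X in measurable X]setTI.
have -> : rejection t b = (fun w => maxabs (zvec (X w) (X w *m b + eps w))) @^-1` `]t, +oo[.
  by apply/seteqP; split => w; rewrite /= in_itv /= andbT.
exact: mm.
Qed.

Lemma Ebeta_test t b : Ebeta P X eps (xi_test t) b = fine (P (rejection t b)).
Proof.
rewrite /Ebeta; congr fine; rewrite -[in RHS](setIT (rejection t b)).
rewrite -integral_indic //; last exact: measurable_rejection.
apply: eq_integral => w _; rewrite /xi_test indicE.
case: ifP => H; first by rewrite mem_set.
by rewrite memNset //= => H'; rewrite /rejection /= H in H'.
Qed.

Lemma Ebeta_compl t b :
  Ebeta P X eps (fun y M => 1 - xi_test t y M) b = 1 - fine (P (rejection t b)).
Proof.
have mr := measurable_rejection t b.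
transitivity (fine (P (~` rejection t b))); last first.
  by rewrite probability_setC // fineB // fin_num_measure.
rewrite /Ebeta; congr fine; rewrite -[in RHS](setIT (~` rejection t b)).
rewrite -integral_indic //; last exact: measurableC.
apply: eq_integral => w _; rewrite indicE /xi_test.
case: ifP => H; first by rewrite memNset ?subrr //=; apply; exact: H.
by rewrite mem_set ?subr0 //= => H'; rewrite /rejection /= H in H'.
Qed.

End tests.

Section power.
Context (d : measure_display) (Omega : measurableType d) (R : realType).
Variables (P : probability Omega R) (n p : nat).
Variables (X : Omega -> 'M[R]_(n, p)) (eps : Omega -> 'cV[R]_n).
Hypothesis Xeps : gauss_indep P X eps.
Local Notation nondeg := [set w | \det ((X w)^T *m X w) != 0].

Lemma measurable_nondeg : measurable nondeg.
Proof.
have mX := measurable_design Xeps.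
by apply: measurable_det_neq0 => i j; exact: (measurable_mxP (mx_measurable_gram i j)).
Qed.

(* A Gaussian tail bound by the Paley-Zygmund inequality for [expR (c * W)]. *)
Lemma type1_lower (t t0 : R) (j : 'I_p) : P nondeg = 1%E -> 0 <= t0 -> t <= t0 ->
  expR (- (2 * t0 + 2) ^+ 2) / 4 <= fine (P (rejection X eps t 0)).
Proof.
move=> PD t00 tt0; pose c := 2 * t0 + 2.
pose a i (M : 'M[R]_(n, p)) := (invsqrt (M^T *m M) *m M^T) j i.
(* Weight restricting to nonsingular designs, where the whitened rows have norm 1 and [W] is
   standard normal. *)
pose V (M : 'M[R]_(n, p)) : R := (\det (M^T *m M) != 0)%:R.
pose W w := \sum_i a i (X w) * eps w i 0.
have mX := measurable_design Xeps.
have [meps _] := Xeps.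
have mN := measurable_nondeg.
have ma i : mx_measurable (a i) by exact: mx_measurable_whitening.
have mV : mx_measurable V.
  move=> d' T Y mY; rewrite /V.
  have mD : measurable [set w | \det ((Y w)^T *m Y w) != 0].
    apply: measurable_det_neq0 => i k.
    exact: (measurable_mxP (mx_measurable_gram i k) mY).
  rewrite (_ : (fun w => _) = \1_[set w | \det ((Y w)^T *m Y w) != 0]).
    exact: measurable_indic.
  apply/funext => w; rewrite indicE.
  case: (boolP (\det ((Y w)^T *m Y w) != 0)) => H; first by rewrite mem_set.
  by rewrite memNset //=; exact/negP.
have mW : measurable_fun setT W.
  apply: measurable_sum => i; apply: measurable_funM => //.
  exact: (measurable_mxP (ma i) mX).
have mVX : measurable_fun setT (fun w => V (X w)) by exact: (measurable_mxP mV mX).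
have mgf q : (\int[P]_w (V (X w) * expR (q * W w))%:E = (expR (q ^+ 2 / 2))%:E)%E.
  transitivity (\int[P]_w (V (X w) * expR (\sum_i (q * a i (X w)) * eps w i 0))%:E)%E.
    apply: eq_integral => w _; congr (V _ * expR _)%:E.
    by rewrite mulr_sumr; apply: eq_bigr => i _; rewrite mulrA.
  rewrite (gaussian_mixture_mgf Xeps (a := fun i M => q * a i M) (V := V)) //; last first.
    by move=> i d' T Y mY; apply: measurable_funM => //; exact: ma.
  transitivity (\int[P]_w ((expR (q ^+ 2 / 2))%:E * (\1_nondeg w)%:E))%E.
    apply: eq_integral => w _; rewrite -EFinM; congr EFin.
    rewrite mulrC indicE /V; case: (boolP (_ != 0)) => H; last first.
      by rewrite mulr0 memNset ?mulr0 //=; exact/negP.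
    rewrite mem_set //= !mulr1; congr expR.
    rewrite -mulr_suml; congr (_ / _).
    under eq_bigr do rewrite exprMn.
    by rewrite -mulr_sumr /a whitened_row_norm // mulr1.
  rewrite ge0_integralZl // ?lee_fin ?expR_ge0 //; last first.
    by apply/measurable_EFinP; exact: measurable_indic.
  by rewrite integral_indic // setIT [X in (_ * X)%E](_ : _ = 1%E) ?mule1.
set m := expR (c ^+ 2 / 2); set v := expR ((2 * c) ^+ 2 / 2).
have m0 : 0 < m by exact: expR_gt0.
have v0 : 0 < v by exact: expR_gt0.
(* Integrating [pw] below gives [P E >= b m - b ^ 2 v]; this [b] maximizes the right side, with
   value [m ^ 2 / (4 v) = exp (- c ^ 2) / 4]. *)
pose b := m / (2 * v).
have b0 : 0 < b by rewrite divr_gt0 // mulr_gt0.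
have c2 : 2 <= c by rewrite /c; lra.
(* The reason for [c = 2 t0 + 2]: then [c ^ 2 / 2 = c t0 + c], and [exp c >= 2], so the values
   [W <= t0] carry at most half of the mean [m]. *)
have half : expR (c * t0) <= m / 2.
  rewrite ler_pdivlMr // /m.
  have -> : c ^+ 2 / 2 = c * t0 + c by rewrite /c; field.
  rewrite expRD ler_pM2l ?expR_gt0 //.
  apply: le_trans (expR_ge1Dx c); lra.
set E := rejection X eps t 0.
have mE : measurable E by exact: (measurable_rejection Xeps).
have EW w : \det ((X w)^T *m X w) != 0 -> t0 < W w -> E w.
  move=> Dw Ww; apply: (le_lt_trans tt0).
  apply: (lt_le_trans Ww); apply: le_trans (le_maxabs _ j).
  by rewrite zvecE mulmx0 mxE add0r ler_norm.
(* Linearized Cauchy-Schwarz: where [W > t0], [2 b Z <= 1 + b ^ 2 Z ^ 2]; elsewhere [Z <= m / 2]. *)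
have pw w : 2 * b * (V (X w) * expR (c * W w)) <=
    \1_E w + b ^+ 2 * (V (X w) * expR (2 * c * W w)) + b * m.
  have -> : 2 * c * W w = c * W w + c * W w by ring.
  rewrite expRD; set Z := expR (c * W w).
  have Z0 : 0 < Z by exact: expR_gt0.
  have bm : 0 < b * m by exact: mulr_gt0.
  have I0 : (0 : R) <= \1_E w by rewrite indicE ler0n.
  rewrite /V; case: (boolP (_ != 0)) => Dw; rewrite ?mul0r ?mul1r ?mulr0 /=; last lra.
  have [Ww|Ww] := ltP t0 (W w).
    rewrite indicE mem_set /=; last exact: EW.
    by have := sqr_ge0 (1 - b * Z); rewrite !expr2; lra.
  have : Z <= m / 2.
    apply: le_trans half; rewrite ler_expR ler_pM2l //; lra.
  by nra.
have mexp q : measurable_fun setT (fun w => (V (X w) * expR (q * W w))%:E).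
  apply/measurable_EFinP; apply: measurable_funM => //.
  by apply: (measurableT_comp (@measurable_expR R)); exact: measurable_funM.
have V0 w : 0 <= V (X w) by rewrite /V ler0n.
have e0 q w : (0 <= (V (X w) * expR (q * W w))%:E)%E.
  by rewrite lee_fin mulr_ge0 // expR_ge0.
have I0 w : (0 <= (\1_E w : R)%:E)%E by rewrite lee_fin indicE ler0n.
have mI : measurable_fun setT (fun w => (\1_E w : R)%:E).
  by apply/measurable_EFinP; exact: measurable_indic.
have key : ((2 * b * m)%:E <= P E + (b ^+ 2 * v + b * m)%:E)%E.
  rewrite EFinM EFinD [X in (_ + (X + _))%E]EFinM /v /m -!mgf.
  rewrite -ge0_integralZl //; last by rewrite lee_fin mulr_ge0 // ltW.
  rewrite -ge0_integralZl //; last by rewrite lee_fin sqr_ge0.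
  rewrite -/m.
  have -> : ((b * m)%:E = \int[P]_w (cst (b * m)%:E w))%E.
    rewrite integral_cst // [X in (_ * X)%E](_ : _ = 1%E) ?mule1 //.
    exact: probability_setT.
  have -> : (P E = \int[P]_w (\1_E w)%:E)%E by rewrite integral_indic // setIT.
  have b2e0 w : (0 <= (b ^+ 2)%:E * (V (X w) * expR (2 * c * W w))%:E)%E.
    by rewrite mule_ge0 // lee_fin sqr_ge0.
  have bm0 : (0 <= (b * m)%:E)%E by rewrite lee_fin mulr_ge0 // ltW.
  rewrite -ge0_integralD //; last exact: measurable_funeM.
  rewrite -ge0_integralD //; last 2 first.
    by move=> w _; rewrite adde_ge0.
    by apply: emeasurable_funD => //; exact: measurable_funeM.
  apply: ge0_le_integral => //.
  - by move=> w _; rewrite mule_ge0 // lee_fin mulr_ge0 // ltW.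
  - exact: measurable_funeM.
  - by apply: emeasurable_funD => //; apply: emeasurable_funD => //; exact: measurable_funeM.
  - move=> w _; rewrite -!EFinM -!EFinD lee_fin; have := pw w; lra.
have := key; rewrite -(fineK (fin_num_measure P E mE)) -EFinD lee_fin => key'.
have -> : expR (- (2 * t0 + 2) ^+ 2) / 4 = b * m - b ^+ 2 * v.
  have -> : b * m - b ^+ 2 * v = m ^+ 2 / v / 4 by rewrite /b; field; rewrite gt_eqF.
  congr (_ / _); rewrite /m /v -expRM_natl -expRN -expRD -/c; congr expR.
  by field.
lra.
Qed.

End power.

(** * Type II error *)

(** A crude form of [cosh x <= exp (x ^ 2 / 2)]. For [x ^ 2 <= 1/2], [exp y <= 1 / (1 - y)] bounds
    the sum by [2 / (1 - x ^ 2)]; for larger [x ^ 2], both [x] and [- x] are at most [2 x ^ 2]. *)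
Lemma expR_sym_le (R : realType) (x : R) :
  expR x + expR (- x) <= 2 * expR (2 * x ^+ 2).
Proof.
have [x2|x2] := leP (x ^+ 2) (1 / 2).
  have xl : -1 < x < 1 by apply/andP; split; nra.
  have inv (y : R) : y < 1 -> expR y <= (1 - y)^-1.
    move=> y1; rewrite -[expR y]invrK -expRN lef_pV2 ?posrE ?expR_gt0 ?subr_gt0 //.
    by have := expR_ge1Dx (- y).
  have E := expR_ge1Dx (2 * x ^+ 2).
  have x1 : x < 1 by case/andP: xl.
  have x1' : - x < 1 by case/andP: xl; lra.
  have I1 := inv _ x1; have I2 := inv _ x1'.
  suff : (1 - x)^-1 + (1 - - x)^-1 <= 2 * (1 + 2 * x ^+ 2) by lra.
  have u0 : 0 < 1 - x ^+ 2 by lra.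
  have -> : (1 - x)^-1 + (1 - - x)^-1 = 2 / (1 - x ^+ 2).
    have h1 : 1 - x != 0 by rewrite gt_eqF //; lra.
    have h2 : 1 + x != 0 by rewrite gt_eqF //; lra.
    have h3 : 1 - x ^+ 2 != 0 by rewrite gt_eqF.
    have h4 : 1 - - x != 0 by rewrite opprK.
    by field; rewrite ?h1 ?h2 ?h3 ?h4 //.
  rewrite ler_pdivrMr //; have := sqr_ge0 x; nra.
have H : x <= 2 * x ^+ 2 /\ - x <= 2 * x ^+ 2 by split; nra.
have : expR x <= expR (2 * x ^+ 2) by rewrite ler_expR; case: H.
have : expR (- x) <= expR (2 * x ^+ 2) by rewrite ler_expR; case: H.
lra.
Qed.

Lemma sum_signs_expR (R : realType) (p : nat) (x : 'I_p -> R) :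
  \sum_(sg : {ffun 'I_p -> bool}) expR (\sum_i (-1) ^+ sg i * x i) =
  \prod_i (expR (x i) + expR (- x i)).
Proof.
transitivity (\prod_(i < p) \sum_(c : bool) expR ((-1) ^+ c * x i)).
  rewrite bigA_distr_bigA; apply: eq_bigr => sg _; exact: expR_sum.
apply: eq_bigr => i _.
by rewrite big_bool /= expr0 expr1 mulN1r mul1r addrC.
Qed.

(** Sub-Gaussian bound for a Rademacher sum; [2 ^+ p] appears because the signs are summed over, not
    averaged. *)
Lemma sum_signs_expR_le (R : realType) (p : nat) (x : 'I_p -> R) :
  \sum_(sg : {ffun 'I_p -> bool}) expR (\sum_i (-1) ^+ sg i * x i) <=
  2 ^+ p * expR (2 * \sum_i x i ^+ 2).
Proof.
rewrite sum_signs_expR mulr_sumr expR_sum -[in 2 ^+ p](card_ord p) -prodr_const.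
rewrite -big_split /=; apply: ler_prod => i _.
by rewrite addr_ge0 ?expR_ge0 //= expR_sym_le.
Qed.

(** Signs are attached to all [p] coordinates, although those beyond [s] have no effect, so that
    sums run over a full function space and factorize; the resulting multiplicities cancel in the
    average. *)
Definition signed_spike (R : realType) (p s : nat) (A : R) (sg : {ffun 'I_p -> bool}) :
    'cV[R]_p :=
  \col_j ((-1) ^+ sg j * (if (j < s)%N then A else 0)).

Lemma signed_spike_Xi (R : realType) (p s : nat) (A : R) sg :
  (s <= p)%N -> 0 < A -> Xi s A (signed_spike s A sg : 'cV[R]_p).
Proof.
move=> sp A0.
have nz j : (signed_spike s A sg j 0 != 0) = (j < s)%N.
  rewrite mxE mulf_eq0 signr_eq0 /=; case: ifP => _; last by rewrite eqxx.
  by rewrite gt_eqF.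
split.
  rewrite -sum1_card (eq_bigl (fun j : 'I_p => (j < s)%N)).
    by rewrite -(big_ord_widen p (fun=> 1%N)) // sum1_card card_ord.
  by move=> j; rewrite -nz; apply/idP/idP; rewrite inE.
move=> j; rewrite nz mxE normrM normrX normrN1 expr1n mul1r => ->.
by rewrite gtr0_norm.
Qed.

Section type_two_error.
Context (d : measure_display) (Omega : measurableType d) (R : realType).
Variables (P : probability Omega R) (n p : nat).
Variables (X : Omega -> 'M[R]_(n, p)) (eps : Omega -> 'cV[R]_n).
Hypothesis Xeps : gauss_indep P X eps.

(** Boolean, so that it can serve as the 0/1 weight [V] inside integrals. *)
Definition good_design (C : R) (M : 'M[R]_(n, p)) :=
  (\det (M^T *m M) != 0) && [forall j, (M^T *m M) j j <= C].

Lemma measurable_good (C : R) (d' : measure_display) (T : measurableType d')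
  (Y : T -> 'M[R]_(n, p)) : measurable_mx Y -> measurable [set w | good_design C (Y w)].
Proof.
move=> mY.
have -> : [set w | good_design C (Y w)] = [set w | \det ((Y w)^T *m Y w) != 0] `&`
    \bigcap_(j in setT) (fun w => ((Y w)^T *m Y w) j j) @^-1` `]-oo, C].
  apply/seteqP; split => w /=.
    move=> /andP[D /forallP H]; split => // j _ /=.
    by rewrite in_itv /=; exact: H.
  move=> [D H]; rewrite /good_design D /=; apply/forallP => j.
  by have := H j I; rewrite /= in_itv.
apply: measurableI.
  apply: measurable_det_neq0 => i j.
  exact: (measurable_mxP (mx_measurable_gram i j) mY).
apply: fin_bigcap_measurable => [|j _]; first exact: finite_finset.
rewrite -[X in measurable X]setTI.
exact: (measurable_mxP (mx_measurable_gram j j) mY).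
Qed.

Let V C (M : 'M[R]_(n, p)) : R := (good_design C M)%:R.

Let mV C : mx_measurable (V C).
Proof.
move=> d' T Y mY; rewrite /V.
rewrite (_ : (fun w => _) = \1_[set w | good_design C (Y w)]).
  by apply: measurable_indic; exact: measurable_good.
apply/funext => w; rewrite indicE.
case: (boolP (good_design C (Y w))) => H; first by rewrite mem_set.
by rewrite memNset //=; exact/negP.
Qed.

Let V0 C M : 0 <= V C M. Proof. by rewrite /V ler0n. Qed.

Let z b j w := zvec (X w) (X w *m b + eps w) j 0.

Let mz b j : measurable_fun setT (z b j).
Proof. exact: (measurable_zvec Xeps). Qed.

Let mVexp C q b j : measurable_fun setT (fun w => (V C (X w) * expR (q * z b j w))%:E).
Proof.
apply/measurable_EFinP; apply: measurable_funM.
  exact: (measurable_mxP (@mV C) (measurable_design Xeps)).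
by apply: (measurableT_comp (@measurable_expR R)); exact: measurable_funM.
Qed.

Let Vexp0 C q b j w : (0 <= (V C (X w) * expR (q * z b j w))%:E)%E.
Proof. by rewrite lee_fin mulr_ge0 // expR_ge0. Qed.

(* Averaging over the signs replaces the correlations between the columns of the
   design by their norms only. *)
Let sum_signs_mgf (C q A : R) s j : 0 <= C ->
  (\sum_(sg : {ffun 'I_p -> bool})
     \int[P]_w (V C (X w) * expR (q * z (signed_spike s A sg) j w))%:E <=
   (2 ^+ p * expR (2 * q ^+ 2 * A ^+ 2 * C + q ^+ 2 / 2))%:E)%E.
Proof.
move=> C0.
pose a i (M : 'M[R]_(n, p)) := (invsqrt (M^T *m M) *m M^T) j i.
pose H (M : 'M[R]_(n, p)) := invsqrt (M^T *m M) *m (M^T *m M).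
have mX := measurable_design Xeps.
have ma i : mx_measurable (a i) by exact: mx_measurable_whitening.
(* Given the design, the signal part is constant and the noise part is standard normal, which
   contributes [q ^ 2 / 2]. *)
have mgf b : (\int[P]_w (V C (X w) * expR (q * z b j w))%:E =
    \int[P]_w (V C (X w) * expR (q * (H (X w) *m b) j 0 + q ^+ 2 / 2))%:E)%E.
  pose V' M := V C M * expR (q * (H M *m b) j 0).
  transitivity (\int[P]_w (V' (X w) *
      expR (\sum_i (q * a i (X w)) * eps w i 0))%:E)%E.
    apply: eq_integral => w _; rewrite /V' -mulrA -expRD /z zvecE mulrDr.
    congr (_ * expR (_ + _))%:E; rewrite mulr_sumr.
    by apply: eq_bigr => i _; rewrite mulrA.
  rewrite (gaussian_mixture_mgf Xeps (a := fun i M => q * a i M) (V := V')); first last.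
  - by move=> M; rewrite mulr_ge0 ?expR_ge0.
  - move=> d' T Y mY; apply: measurable_funM; first exact: mV.
    apply: (measurableT_comp (@measurable_expR R)); apply: measurable_funM => //.
    exact: (measurable_mxP (mx_measurable_signal b j) mY).
  - by move=> i d' T Y mY; apply: measurable_funM => //; exact: ma.
  apply: eq_integral => w _; rewrite /V' -mulrA -expRD.
  rewrite /V; case: (boolP (good_design C (X w))) => Gw; last by rewrite !mul0r.
  congr (_ * expR (_ + _))%:E; rewrite -mulr_suml; congr (_ / _).
  under eq_bigr do rewrite exprMn.
  have /andP[Dw _] := Gw.
  by rewrite -mulr_sumr /a whitened_row_norm // mulr1.
under eq_bigr do rewrite mgf.
rewrite -ge0_integral_sum //; last 2 first.
- move=> sg; apply/measurable_EFinP; apply: measurable_funM.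
    exact: (measurable_mxP (@mV C) mX).
  apply: (measurableT_comp (@measurable_expR R)); apply: measurable_funD => //.
  apply: measurable_funM => //.
  exact: (measurable_mxP (mx_measurable_signal _ j) mX).
- by move=> sg w _; rewrite lee_fin mulr_ge0 // expR_ge0.
set K := (2 ^+ p * _)%:E.
have -> : (K = \int[P]_w cst K w)%E.
  rewrite integral_cst // [X in (_ * X)%E](_ : _ = 1%E) ?mule1 //.
  exact: probability_setT.
apply: ge0_le_integral => //.
- by move=> w _; apply: sume_ge0 => sg _; rewrite lee_fin mulr_ge0 // expR_ge0.
- apply: emeasurable_sum => sg; apply/measurable_EFinP; apply: measurable_funM.
    exact: (measurable_mxP (@mV C) mX).
  apply: (measurableT_comp (@measurable_expR R)); apply: measurable_funD => //.
  apply: measurable_funM => //.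
  exact: (measurable_mxP (mx_measurable_signal _ j) mX).
move=> w _; rewrite sumEFin lee_fin /V.
case: (boolP (good_design C (X w))) => Gw; last first.
  by rewrite big1 ?mulr_ge0 ?exprn_ge0 ?expR_ge0 // => sg _; rewrite mul0r.
under eq_bigr do rewrite mul1r expRD.
rewrite -mulr_suml expRD mulrA ler_pM2r ?expR_gt0 //.
pose x i := q * H (X w) j i * (if (i < s)%N then A else 0).
have xE sg : q * (H (X w) *m signed_spike s A sg) j 0 = \sum_i (-1) ^+ sg i * x i.
  rewrite mxE mulr_sumr; apply: eq_bigr => i _; rewrite [X in _ * (_ * X)]mxE /x.
  by move: (if _ then _ else _) ((-1) ^+ _) => u v; ring.
under eq_bigr do rewrite xE.
apply: (le_trans (sum_signs_expR_le x)).
rewrite ler_pM2l ?exprn_gt0 // ler_expR.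
have -> : 2 * q ^+ 2 * A ^+ 2 * C = 2 * (q ^+ 2 * A ^+ 2 * C) by rewrite !mulrA.
rewrite ler_pM2l //.
have /andP[Dw /forallP/(_ j) GC] := Gw.
apply: (@le_trans _ _ (q ^+ 2 * A ^+ 2 * ((X w)^T *m X w) j j)); last first.
  by rewrite ler_wpM2l // mulr_ge0 ?sqr_ge0.
rewrite -(sqrt_gram_row_norm Dw) mulr_sumr; apply: ler_sum => i _.
rewrite /x -/(H (X w)); case: ifP => _.
  by rewrite !exprMn mulrAC.
by rewrite mulr0 expr0n /=; apply: mulr_ge0; [apply: mulr_ge0|]; exact: sqr_ge0.
Qed.

(** Off the bad designs, a union over [p] coordinates and two tails gives the factor [2 p], each
    tail being bounded by Chernoff with parameter [c]. The bound holds on average over the signs,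
    hence for at least one pattern. *)
Lemma type2_upper (t c A C : R) s : (s <= p)%N -> 0 < A -> 0 <= t -> 0 <= c -> 0 <= C ->
  exists2 b, Xi s A b & fine (P (rejection X eps t b)) <=
    fine (P (~` [set w | good_design C (X w)])) +
    2 * p%:R * expR (2 * c ^+ 2 * A ^+ 2 * C + c ^+ 2 / 2 - c * t).
Proof.
move=> sp A0 t0 c0 C0; have mX := measurable_design Xeps.
have mG := measurable_good C mX.
set G := [set w | good_design C (X w)] in mG *.
set e := expR (2 * c ^+ 2 * A ^+ 2 * C + c ^+ 2 / 2).
pose J q j sg := (\int[P]_w (V C (X w) * expR (q * z (signed_spike s A sg) j w))%:E)%E.
have one sg : (P (rejection X eps t (signed_spike s A sg)) <=
    P (~` G) + \sum_j (expR (- (c * t)))%:E * (J c j sg + J (- c)%R j sg))%E.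
  set b := signed_spike s A sg.
  have mE : measurable (rejection X eps t b) by exact: (measurable_rejection Xeps).
  have -> : P (rejection X eps t b) = (\int[P]_w (\1_(rejection X eps t b) w)%:E)%E.
    by rewrite integral_indic // setIT.
  have -> : P (~` G) = (\int[P]_w (\1_(~` G) w)%:E)%E.
    by rewrite integral_indic ?setIT //; exact: measurableC.
  pose h j w := ((expR (- (c * t)))%:E * ((V C (X w) * expR (c * z b j w))%:E +
    (V C (X w) * expR ((- c) * z b j w))%:E))%E.
  have h0 j w : (0 <= h j w)%E.
    by rewrite mule_ge0 ?adde_ge0 ?Vexp0 // lee_fin expR_ge0.
  have mh j : measurable_fun setT (h j).
    by apply: measurable_funeM; apply: emeasurable_funD; exact: mVexp.
  have -> : (\sum_j (expR (- (c * t)))%:E * (J c j sg + J (- c)%R j sg) =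
      \int[P]_w \sum_j h j w)%E.
    rewrite ge0_integral_sum //; apply: eq_bigr => j _.
    rewrite ge0_integralZl //.
    - by rewrite ge0_integralD // => w _; exact: Vexp0.
    - by apply: emeasurable_funD; exact: mVexp.
    - by move=> w _; rewrite adde_ge0 ?Vexp0.
  have mI (S : set Omega) : measurable S -> measurable_fun setT (fun w => (\1_S w : R)%:E).
    by move=> mS; apply/measurable_EFinP; exact: measurable_indic.
  have I0 (S : set Omega) w : (0 <= (\1_S w : R)%:E)%E by rewrite lee_fin indicE ler0n.
  rewrite -ge0_integralD //; last 3 first.
  - by apply: mI; exact: measurableC.
  - by move=> w _; apply: sume_ge0 => j _.
  - exact: emeasurable_sum.
  apply: ge0_le_integral => //.
  - exact: mI.
  - apply: emeasurable_funD; first by apply: mI; exact: measurableC.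
    exact: emeasurable_sum.
  move=> w _; have S0 : (0 <= \sum_j h j w)%E by apply: sume_ge0 => j _.
  rewrite [in leLHS]indicE; case: (boolP (w \in _)) => /= [/set_mem Ew|_]; last first.
    by rewrite adde_ge0.
  rewrite indicE; case: (boolP (w \in _)) => /= Gw; first by rewrite leeDl.
  have {}Gw : good_design C (X w).
    by apply: contraNT Gw => Gw; apply/mem_set => /=; exact/negP.
  rewrite add0e.
  have [j tz] := maxabs_gtP t0 Ew.
  rewrite (bigD1 j) //=.
  apply: (@le_trans _ _ (h j w)); last by rewrite leeDl // sume_ge0.
  rewrite /h -EFinD -EFinM lee_fin /V Gw !mul1r mulrDr -!expRD.
  have e0 := expR_ge0 (- (c * t) + c * z b j w).
  have e1 := expR_ge0 (- (c * t) + - c * z b j w).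
  have := tz; rewrite -/(z b j w) lter_normr => /orP[]tz'.
    suff : 1 <= expR (- (c * t) + c * z b j w) by lra.
    by rewrite -expR0 ler_expR addrC subr_ge0 ler_wpM2l // ltW.
  suff : 1 <= expR (- (c * t) + - c * z b j w) by lra.
  by rewrite -expR0 ler_expR addrC mulNr -mulrN subr_ge0 ler_wpM2l // ltW.
have tot : (\sum_(sg : {ffun 'I_p -> bool}) P (rejection X eps t (signed_spike s A sg)) <=
    (2 ^+ p * (fine (P (~` G)) + 2 * p%:R * (e * expR (- (c * t)))))%:E)%E.
  apply: (le_trans (lee_sum _ (fun sg _ => one sg))).
  rewrite big_split /= exchange_big /=.
  have card2 : #|{ffun 'I_p -> bool}| = (2 ^ p)%N by rewrite card_ffun card_bool card_ord.
  rewrite mulrDr EFinD; apply: leeD.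
    rewrite -(fineK (fin_num_measure P _ (measurableC mG))) sumEFin lee_fin.
    by rewrite sumr_const cardT -cardE card2 -[leLHS]mulr_natl natrX.
  have Jle q j : q ^+ 2 = c ^+ 2 -> (\sum_sg J q j sg <= (2 ^+ p * e)%:E)%E.
    by move=> qc; apply: (le_trans (sum_signs_mgf q A s j C0)); rewrite qc.
  have J0 q j sg : (0 <= J q j sg)%E by apply: integral_ge0 => w _; exact: Vexp0.
  apply: (@le_trans _ _ (\sum_(j < p) (expR (- (c * t)) * (2 ^+ p * e + 2 ^+ p * e))%:E)%E).
    apply: lee_sum => j _; rewrite -ge0_sume_distrr; last first.
      by move=> sg _; rewrite adde_ge0.
    rewrite EFinM; apply: lee_wpmul2l; first by rewrite lee_fin expR_ge0.
    by rewrite big_split /= EFinD; apply: leeD; apply: Jle; rewrite ?sqrrN.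
  rewrite sumEFin lee_fin sumr_const card_ord -[leLHS]mulr_natl.
  by rewrite le_eqVlt; apply/orP; left; apply/eqP; ring.
(* If every sign pattern exceeded [B], the sum over the [2 ^ p] patterns would exceed the total
   bounded in [tot]. *)
apply: contrapT => no.
set B := fine _ + _ in no.
have BE : B = fine (P (~` G)) + 2 * p%:R * (e * expR (- (c * t))).
  by rewrite /B expRD.
move: tot; rewrite -BE.
rewrite (eq_bigr (fun sg => (fine (P (rejection X eps t (signed_spike s A sg))))%:E)); last first.
  by move=> sg _; rewrite fineK // fin_num_measure //; exact: (measurable_rejection Xeps).
rewrite sumEFin lee_fin leNgt => /negP; apply.
have -> : 2 ^+ p * B = \sum_(sg : {ffun 'I_p -> bool}) B.
  by rewrite sumr_const cardT -cardE card_ffun card_bool card_ord -[RHS]mulr_natl natrX.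
apply: ltr_sum => [|sg _].
  by apply/hasP; exists [ffun=> true]; rewrite ?mem_index_enum.
rewrite ltNge; apply/negP => H; apply: no.
by exists (signed_spike s A sg) => //; exact: signed_spike_Xi.
Qed.

End type_two_error.

(** * Designs *)

Lemma posdef_det (R : realType) (m : nat) (M : 'M[R]_m) : posdef M -> \det M != 0.
Proof.
move=> pM; apply/negP => /det0P[v v0 vM].
have vT0 : v^T != 0 by apply: contraNneq v0 => vT; rewrite -[v]trmxK vT trmx0.
by have := pM _ vT0; rewrite trmxK vM mul0mx mxE ltxx.
Qed.

(** The left side is nonpositive for [|x| <= b]. For [x > b], [x ^ 2 <= 16 exp (x / 2)] and
    [exp (x / 2) <= exp (- b / 2) exp x]. The excess of a squared entry over [b ^ 2] thus has
    exponentially small mean. *)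
Lemma sqr_le_expR (R : realType) (x b : R) : 0 <= b ->
  x ^+ 2 - b ^+ 2 <= 16 * expR (- (b / 2)) * (expR x + expR (- x)).
Proof.
move=> b0; wlog x0 : x / 0 <= x => [H|].
  have [|x0] := leP 0 x; first exact: H.
  have := H (- x); rewrite sqrrN opprK (addrC (expR (- x))); apply.
  by rewrite oppr_ge0 ltW.
have e0 := expR_gt0 (- (b / 2)); have e1 := expR_gt0 x; have e2 := expR_gt0 (- x).
have [xb|bx] := leP x b.
  apply: (@le_trans _ _ 0); first by rewrite subr_le0 ler_pXn2r.
  by rewrite !mulr_ge0 ?addr_ge0 ?ltW.
have : x ^+ 2 <= 16 * expR (x / 2).
  have -> : x / 2 = x / 4 + x / 4 by field.
  rewrite expRD; have := expR_ge1Dx (x / 4).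
  set y := expR _ => xy; have : 0 <= (y - x / 4) * (y + x / 4) by rewrite mulr_ge0 //; lra.
  nra.
have : expR (x / 2) <= expR (- (b / 2)) * expR x.
  by rewrite -expRD ler_expR; lra.
have : 0 <= expR (- (b / 2)) * expR (- x) by rewrite mulr_ge0 // ltW.
have : 0 <= b ^+ 2 by exact: sqr_ge0.
rewrite mulrDr -!mulrA; lra.
Qed.

Lemma union_bound (d : measure_display) (T : measurableType d) (R : realType)
    (P : probability T R) (I : finType) (A N : set T) (S : I -> set T) :
  measurable A -> measurable N -> (forall j, measurable (S j)) ->
  (forall w, A w -> N w \/ exists j, S j w) ->
  (P A <= P N + \sum_j P (S j))%E.
Proof.
move=> mA mN mS AN.
have PE (B : set T) : measurable B -> P B = (\int[P]_w (\1_B w)%:E)%E.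
  by move=> mB; rewrite integral_indic // setIT.
have mI (B : set T) : measurable B -> measurable_fun setT (fun w => (\1_B w : R)%:E).
  by move=> mB; apply/measurable_EFinP; exact: measurable_indic.
have I0 (B : set T) w : (0 <= (\1_B w : R)%:E)%E by rewrite lee_fin indicE ler0n.
rewrite !PE //; under eq_bigr do rewrite PE //.
rewrite -ge0_integral_sum //; last by move=> j; exact: mI.
have s0 w : (0 <= \sum_j (\1_(S j) w : R)%:E)%E by apply: sume_ge0 => j _.
have ms : measurable_fun setT (fun w => \sum_j (\1_(S j) w : R)%:E)%E.
  by apply: emeasurable_sum => j; exact: mI.
rewrite -ge0_integralD //; last exact: mI.
apply: ge0_le_integral => //; [exact: mI|by apply: emeasurable_funD => //; exact: mI|].
move=> w _; rewrite [in leLHS]indicE.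
case: (boolP (w \in A)) => /= [/set_mem /AN[Nw|[j Sj]]|_]; last by rewrite adde_ge0.
  by rewrite [in leRHS]indicE mem_set //= leeDl.
rewrite (bigD1 j) //= [\1_(S j) w]indicE mem_set //= addeCA leeDl // adde_ge0 //.
by apply: sume_ge0.
Qed.

Section subgaussian_design.
Context (d : measure_display) (Omega : measurableType d) (R : realType).
Variables (P : probability Omega R) (n p : nat) (sigma2 : R).
Variables (X : Omega -> 'M[R]_(n, p)) (eps : Omega -> 'cV[R]_n).
Hypotheses (Xeps : gauss_indep P X eps) (Xsub : SubG P X sigma2).

Lemma SubG_nondeg : P [set w | \det ((X w)^T *m X w) != 0] = 1%E.
Proof.
have [_ [_ [_ [_ [_ [N [mN PN XN]]]]]]] := Xsub.
have mD := measurable_nondeg Xeps.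
apply/eqP; rewrite eq_le probability_le1 //=.
have -> : (1 = P (~` N))%E by rewrite probability_setC // PN sube0.
apply: le_measure; rewrite ?inE //; first exact: measurableC.
move=> w /= Nw; apply: posdef_det; apply: contrapT => npd; apply: Nw.
exact: XN.
Qed.

Lemma SubG_exp_entry k l (t : R) : t ^+ 2 = 1 ->
  (\int[P]_w (expR (t * X w k l))%:E <= (expR (sigma2 / 2))%:E)%E.
Proof.
move=> t1; have [_ [_ [_ [_ [H _]]]]] := Xsub.
have E (f : 'I_p -> R) : \sum_l' (delta_mx 0 l : 'rV[R]_p) 0 l' * f l' = f l.
  rewrite (bigD1 l) //= mxE !eqxx mul1r big1 ?addr0 // => i il.
  by rewrite mxE (negbTE il) andbF mul0r.
have E1 : \sum_l' (delta_mx 0 l : 'rV[R]_p) 0 l' ^+ 2 = 1.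
  by under eq_bigr do rewrite expr2; rewrite E mxE !eqxx.
have := H k _ t E1; rewrite t1 mulr1; apply: le_trans.
by rewrite le_eqVlt; apply/orP; left; apply/eqP; apply: eq_integral => w _; rewrite E.
Qed.

Lemma SubG_gram_tail (b : R) j : (0 < n)%N -> 1 <= 2 * b ^+ 2 -> 0 <= b ->
  (P [set w | (2 * b ^+ 2 * n%:R < ((X w)^T *m X w) j j)%R] <=
   (64 * expR (sigma2 / 2) * expR (- (b / 2)))%:E)%E.
Proof.
move=> n0 b1 b0; have mX := measurable_design Xeps.
set S := [set w | _]; set c := expR (- (b / 2)).
have c0 : 0 < c by exact: expR_gt0.
have nR : 0 < n%:R :> R by rewrite ltr0n.
have mS : measurable S.
  rewrite -[X in measurable X]setTI.
  have -> : S = (fun w => ((X w)^T *m X w) j j) @^-1` `]2 * b ^+ 2 * n%:R, +oo[.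
    by apply/seteqP; split => w; rewrite /= in_itv /= andbT.
  exact: (measurable_mxP (mx_measurable_gram j j) mX).
(* On [S] the total excess over [b ^ 2] is more than [b ^ 2 n >= n / 2], so Markov's inequality
   divides the factor [16 c] by [n / 2]; the two signs of the exponent then turn 32 into 64. *)
pose K := 32 * c / n%:R.
have K0 : 0 <= K by rewrite divr_ge0 ?mulr_ge0 // ltW.
have ME w : ((X w)^T *m X w) j j = \sum_k X w k j ^+ 2.
  by rewrite mxE; apply: eq_bigr => k _; rewrite mxE expr2.
have pw w : (\1_S w : R) <= K * \sum_k (expR (1 * X w k j) + expR (-1 * X w k j)).
  have s0 : 0 <= \sum_k (expR (1 * X w k j) + expR (-1 * X w k j)).
    by apply: sumr_ge0 => k _; rewrite addr_ge0 ?expR_ge0.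
  rewrite indicE; case: (boolP (w \in S)) => /= [/set_mem Sw|_]; last first.
    by rewrite mulr_ge0.
  move: Sw; rewrite /S /= ME => Sw.
  have : \sum_k (X w k j ^+ 2 - b ^+ 2) <=
      16 * c * \sum_k (expR (1 * X w k j) + expR (-1 * X w k j)).
    rewrite mulr_sumr; apply: ler_sum => k _; rewrite mul1r mulN1r.
    exact: sqr_le_expR.
  rewrite big_split /= sumr_const card_ord -mulr_natl.
  set s1 := \sum_k X w k j ^+ 2 in Sw *; set s2 := \sum_k _ in s0 * => H.
  rewrite /K mulrAC ler_pdivlMr // mul1r.
  nra.
have mE t : measurable_fun setT (fun w => \sum_k (expR (t * X w k j))%:E)%E.
  apply: emeasurable_sum => k; apply/measurable_EFinP.
  apply: (measurableT_comp (@measurable_expR R)); exact: measurable_funM.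
have E0 t w : (0 <= \sum_k (expR (t * X w k j))%:E)%E.
  by apply: sume_ge0 => k _; rewrite lee_fin expR_ge0.
have -> : P S = (\int[P]_w (\1_S w)%:E)%E by rewrite integral_indic // setIT.
apply: (@le_trans _ _ (\int[P]_w (K%:E * (\sum_k (expR (1 * X w k j))%:E +
    \sum_k (expR (-1 * X w k j))%:E)))%E).
  apply: ge0_le_integral => //.
  - by apply/measurable_EFinP; exact: measurable_indic.
  - by apply: measurable_funeM; exact: emeasurable_funD.
  - by move=> w _; rewrite !sumEFin -EFinD -EFinM lee_fin -big_split.
rewrite ge0_integralZl //; last 2 first.
- exact: emeasurable_funD.
- by move=> w _; rewrite adde_ge0.
rewrite ge0_integralD //.
have I t : t ^+ 2 = 1 -> (\int[P]_w \sum_k (expR (t * X w k j))%:E <=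
    (n%:R * expR (sigma2 / 2))%:E)%E.
  move=> t1; rewrite ge0_integral_sum //; last first.
    move=> k; apply/measurable_EFinP.
    by apply: (measurableT_comp (@measurable_expR R)); exact: measurable_funM.
  apply: (@le_trans _ _ (\sum_(k < n) (expR (sigma2 / 2))%:E)%E).
    by apply: lee_sum => k _; exact: SubG_exp_entry.
  by rewrite sumEFin sumr_const card_ord mulr_natl.
apply: (@le_trans _ _ (K%:E * ((n%:R * expR (sigma2 / 2))%:E + (n%:R * expR (sigma2 / 2))%:E))%E).
  apply: lee_wpmul2l; first by rewrite lee_fin.
  by apply: leeD; apply: I; rewrite ?sqrrN expr1n.
rewrite -EFinD -EFinM lee_fin le_eqVlt; apply/orP; left; apply/eqP.
by rewrite /K; field; rewrite gt_eqF.
Qed.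

Lemma SubG_bad_design (b : R) : (0 < n)%N -> 1 <= 2 * b ^+ 2 -> 0 <= b ->
  fine (P (~` [set w | good_design (2 * b ^+ 2 * n%:R) (X w)])) <=
  p%:R * (64 * expR (sigma2 / 2) * expR (- (b / 2))).
Proof.
move=> n0 b1 b0; have mX := measurable_design Xeps.
set K := 64 * _ * _; set C := 2 * b ^+ 2 * n%:R.
have mG := measurable_good C mX.
have mD := measurable_nondeg Xeps.
pose S j := [set w | (C < ((X w)^T *m X w) j j)%R].
have mS j : measurable (S j).
  rewrite -[X in measurable X]setTI.
  have -> : S j = (fun w => ((X w)^T *m X w) j j) @^-1` `]C, +oo[.
    by apply/seteqP; split => w; rewrite /= in_itv /= andbT.
  exact: (measurable_mxP (mx_measurable_gram j j) mX).
rewrite -lee_fin fineK ?fin_num_measure //; last exact: measurableC.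
have UB : (P (~` [set w | good_design C (X w)]) <=
    P (~` [set w | \det ((X w)^T *m X w) != 0%R]) + \sum_j P (S j))%E.
  apply: union_bound => //; [exact: measurableC|exact: measurableC|].
  move=> w /= /negP; rewrite negb_and => /orP[nD|]; first by left; exact/negP.
  by move=> /forallPn[j jC]; right; exists j; rewrite /S /= ltNge.
apply: (le_trans UB).
rewrite probability_setC // SubG_nondeg subee // add0e.
apply: (@le_trans _ _ (\sum_(j < p) K%:E)%E).
  by apply: lee_sum => j _; exact: SubG_gram_tail.
by rewrite sumEFin sumr_const card_ord mulr_natl.
Qed.

End subgaussian_design.

Section orthogonal_design.
Context (d : measure_display) (Omega : measurableType d) (R : realType).
Variables (P : probability Omega R) (n p : nat) (X : Omega -> 'M[R]_(n, p)).
Hypotheses (XO : Orth X) (n0 : (0 < n)%N).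

Let det0 w : \det ((X w)^T *m X w) != 0.
Proof. by rewrite XO det_scalar expf_neq0 // pnatr_eq0 -lt0n. Qed.

Lemma Orth_nondeg : P [set w | \det ((X w)^T *m X w) != 0] = 1%E.
Proof.
rewrite -(@probability_setT _ _ _ P); congr (P _).
by apply/seteqP; split => // w _; exact: det0.
Qed.

Lemma Orth_bad_design (C : R) : n%:R <= C ->
  fine (P (~` [set w | good_design C (X w)])) = 0.
Proof.
move=> nC; rewrite (_ : [set w | _] = setT) ?setCT ?measure0 //.
apply/seteqP; split => // w _; rewrite /= /good_design det0 /=.
by apply/forallP => j; rewrite XO mxE eqxx mulr1n.
Qed.

End orthogonal_design.

(** * Risk of the threshold test at fixed dimension *)

Section risk.
Context (d : measure_display) (Omega : measurableType d) (R : realType).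
Variables (P : probability Omega R) (n p : nat).
Variables (X : Omega -> 'M[R]_(n, p)) (eps : Omega -> 'cV[R]_n).
Hypothesis Xeps : gauss_indep P X eps.

Lemma risk_lower (t t0 c A C : R) s :
  P [set w | \det ((X w)^T *m X w) != 0] = 1%E ->
  (0 < p)%N -> (s <= p)%N -> 0 < A -> 0 <= t0 -> 0 <= c -> 0 <= C ->
  fine (P (~` [set w | good_design C (X w)])) +
    2 * p%:R * expR (2 * c ^+ 2 * A ^+ 2 * C + c ^+ 2 / 2 - c * t0) <= 1 / 2 ->
  expR (- (2 * t0 + 2) ^+ 2) / 4 <= Risk P X eps (xi_test t) s A.
Proof.
move=> PD p0 sp A0 t00 c0 C0 small; rewrite /Risk.
have rej_ge0 b : 0 <= fine (P (rejection X eps t b)) by exact/fine_ge0/measure_ge0.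
have rej_le1 b : fine (P (rejection X eps t b)) <= 1.
  rewrite -lee_fin fineK ?probability_le1 ?fin_num_measure //;
  exact: (measurable_rejection Xeps).
set D := [set _ | _ in Xi s A].
have le_sup b : Xi s A b -> 1 - fine (P (rejection X eps t b)) <= sup D.
  move=> Xb; apply: ub_le_sup.
    by exists 1 => _ [b' _ <-]; rewrite (Ebeta_compl Xeps) gerBl.
  by exists b => //; rewrite (Ebeta_compl Xeps).
rewrite (Ebeta_test Xeps); have [tt0|t0t] := leP t t0.
  apply: (le_trans (type1_lower Xeps (Ordinal p0) PD t00 tt0)).
  (* For small thresholds the type II term only has to be nonnegative, which follows from any one
     member of [Xi s A]. *)
  rewrite lerDl; apply: le_trans (le_sup _ (signed_spike_Xi [ffun=> true] sp A0)).
  by rewrite subr_ge0.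
have [|b Xb Hb] := @type2_upper _ _ _ P n p X eps Xeps t c A C s sp A0 _ c0 C0.
  by rewrite (le_trans t00) // ltW.
have S := le_sup _ Xb; have R0 := rej_ge0 0.
have : expR (- (2 * t0 + 2) ^+ 2) <= 1 by rewrite -expR0 ler_expR oppr_le0 sqr_ge0.
have : expR (2 * c ^+ 2 * A ^+ 2 * C + c ^+ 2 / 2 - c * t) <=
    expR (2 * c ^+ 2 * A ^+ 2 * C + c ^+ 2 / 2 - c * t0).
  by rewrite ler_expR lerD2l lerN2 ler_wpM2l // ltW.
move=> /(@ler_wpM2l _ (2 * p%:R)); rewrite mulr_ge0 ?ler0n // => /(_ isT).
lra.
Qed.

Lemma inf_risk_lower (t0 c A C : R) s :
  P [set w | \det ((X w)^T *m X w) != 0] = 1%E ->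
  (0 < p)%N -> (s <= p)%N -> 0 < A -> 0 <= t0 -> 0 <= c -> 0 <= C ->
  fine (P (~` [set w | good_design C (X w)])) +
    2 * p%:R * expR (2 * c ^+ 2 * A ^+ 2 * C + c ^+ 2 / 2 - c * t0) <= 1 / 2 ->
  expR (- (2 * t0 + 2) ^+ 2) / 4 <=
    inf [set Risk P X eps (xi_test t) s A | t in [set: R]].
Proof.
move=> PD p0 sp A0 t00 c0 C0 small; apply: lb_le_inf.
  by exists (Risk P X eps (xi_test 0) s A), 0.
by move=> _ [t _ <-]; exact: (risk_lower _ PD p0 sp A0 t00 c0 C0 small).
Qed.

End risk.

(** An eventual bound passes to the lower limit only as a weak inequality; the gap between [a] and
    [b] supplies the strict one. *)
Lemma lt_limn_einf (R : realType) (u : (\bar R)^nat) (a b : \bar R) :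
  (a < b)%E -> (\forall k \near \oo, (b <= u k)%E) -> (a < limn_einf u)%E.
Proof.
move=> ab [N _ Nu]; apply: (lt_le_trans ab).
rewrite limn_einf_lim (cvg_lim _ (@cvg_einfs_sup _ u)) //.
apply: (@le_trans _ _ (einfs u N)); last by apply: ereal_sup_ubound; exists N.
by apply: le_ereal_inf_tmp => _ [k /= Nk <-]; exact: Nu.
Qed.

(** * Growth of the sparsity with the dimension *)

Section sparsity.
Variables (R : realType) (alpha : R).
Hypothesis halpha : 0 < alpha < 1.
Local Notation s p := (Num.truncn ((p%:R : R) `^ (1 - alpha))).

Lemma sparsity_le p : (0 < p)%N -> (s p <= p)%N.
Proof.
move=> p0; have p1 : 1 <= p%:R :> R by rewrite ler1n.
rewrite -(@ler_nat R).
apply: (@le_trans _ _ (p%:R `^ (1 - alpha))); first by rewrite truncn_le powR_ge0.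
by rewrite -[leRHS]powRr1 ?ler0n // ler_powR //; case/andP: halpha => a0 a1; lra.
Qed.

(** With [y = (1 - alpha) L / 8], the real sparsity is [exp (8 y) >= y ^ 8], and a fourth root
    leaves [y ^ 2]. The factor 1/2, which is 1/16 before the root, absorbs the rounding. *)
Lemma sparsity_lower p : (0 < p)%N -> let L := ln (p%:R : R) in
  (0 < s p)%N /\ ((1 - alpha) / 8) ^+ 2 / 2 * L ^+ 2 <= Num.sqrt (Num.sqrt (s p)%:R).
Proof.
move=> p0 L; have [a0 a1] := andP halpha.
have p1 : 1 <= p%:R :> R by rewrite ler1n.
have L0 : 0 <= L by exact: ln_ge0.
have xE : p%:R `^ (1 - alpha) = expR ((1 - alpha) * L).
  by rewrite /powR gt_eqF // ltr0n.
have x1 : 1 <= (p%:R : R) `^ (1 - alpha).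
  by rewrite xE -[leLHS]expR0 ler_expR mulr_ge0 // subr_ge0 ltW.
have s1 : (0 < s p)%N by rewrite truncn_gt0.
split => //.
have := truncnS_gt ((p%:R : R) `^ (1 - alpha)).
have s1R : 1 <= (s p)%:R :> R by rewrite ler1n.
rewrite -natr1 xE => xs.
set y := (1 - alpha) / 8 * L.
have y0 : 0 <= y by rewrite mulr_ge0 // divr_ge0 // subr_ge0 ltW.
have ey : y ^+ 8 <= expR ((1 - alpha) * L).
  have -> : (1 - alpha) * L = 8%:R * y by rewrite /y; field.
  rewrite expRM_natl ler_pXn2r ?nnegrE ?expR_ge0 //.
  by apply: le_trans (expR_ge1Dx y); rewrite lerDr.
rewrite xE in s1R *; set v := Num.truncn _ in s1R xs *.
have -> : ((1 - alpha) / 8) ^+ 2 / 2 * L ^+ 2 = y ^+ 2 / 2 by rewrite /y; ring.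
have h0 : 0 <= y ^+ 2 / 2 by rewrite divr_ge0 // sqr_ge0.
rewrite -(ger0_norm h0) -sqrtr_sqr ler_wsqrtr // -[leLHS]ger0_norm ?sqr_ge0 //.
rewrite -sqrtr_sqr ler_wsqrtr //.
have -> : ((y ^+ 2 / 2) ^+ 2) ^+ 2 = y ^+ 8 / 16 by field.
have : 0 <= y ^+ 8 by exact: exprn_ge0.
lra.
Qed.

(* [b] grows at least like [L ^+ 2], so [expR (- (g * b))] beats [p = expR L]. *)
Lemma near_small (g K : R) : 0 < g -> 0 < K ->
  exists L0 : R, forall p, (0 < p)%N -> L0 <= ln (p%:R : R) ->
  K * p%:R * expR (- (g * Num.sqrt (Num.sqrt (s p)%:R))) <= 1 / 4.
Proof.
move=> g0 K0; have [a0 a1] := andP halpha.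
pose h := ((1 - alpha) / 8) ^+ 2 / 2.
have h0 : 0 < h by rewrite divr_gt0 // exprn_gt0 // divr_gt0 // subr_gt0.
(* The first term forces [g b >= 2 L], leaving [K exp (- L)]; the second forces [exp L >= 4 K]. *)
exists (2 / (g * h) + 4 * K) => p p0 Lp.
have [_ sl] := sparsity_lower p0; set L := ln _ in Lp sl.
set b := Num.sqrt _ in sl *.
have gh0 : 0 < g * h by exact: mulr_gt0.
have q0 : 0 <= 2 / (g * h) by rewrite divr_ge0 // ltW.
have L0 : 0 <= L by lra.
have L1 : 2 <= g * h * L.
  have : 2 / (g * h) <= L by lra.
  by rewrite ler_pdivrMr // mulrC.
have -> : p%:R = expR L by rewrite /L lnK // posrE ltr0n.
rewrite -mulrA -expRD; apply: (@le_trans _ _ (K * expR (- L))).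
  rewrite ler_pM2l // ler_expR.
  have : g * (h * L ^+ 2) <= g * b by rewrite ler_pM2l.
  have : 2 * L <= g * h * L * L by rewrite ler_wpM2r.
  rewrite expr2; lra.
rewrite expRN -[_ / _]/(_ * _) ler_pdivrMr ?expR_gt0 //.
have := expR_ge1Dx L; lra.
Qed.

End sparsity.

(** * Choice of parameters and passage to the limit *)

Theorem mainTheorem11 (R : realType) (alpha r sigma2 : R)
  (halpha : 1 / 2 < alpha < 1) (hr : alpha < r) (hsigma : 0 < sigma2)
  (n : nat -> nat) (hn : (fun p => (n p)%:R : R) @ \oo --> +oo)
  (d : nat -> measure_display) (Omega : forall p, measurableType (d p))
  (P : forall p, probability (Omega p) R)
  (X : forall p, Omega p -> 'M[R]_(n p, p))
  (eps : forall p, Omega p -> 'cV[R]_(n p))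
  (hgauss : forall p, gauss_indep (P p) (X p) (eps p))
  (hdesign :
     ((forall p, SubG (P p) (X p) sigma2) /\
      (fun p => (n p)%:R / (p%:R `^ (3 / 2)) : R) @ \oo --> +oo)
     \/ ((forall p, Orth (X p)) /\ (forall p, (p <= n p)%N))) :
  let s := fun p : nat => Num.truncn ((p%:R : R) `^ (1 - alpha)) in
  let A := fun p : nat => Num.sqrt (2 * r * ln (p%:R : R) / (n p)%:R) in
  let infRisk := fun p : nat =>
    inf [set Risk (P p) (X p) (eps p) (xi_test t) (s p) (A p) | t in [set: R]] in
  ((- ((r - alpha) ^+ 2 / (4 * r)))%:E <
     limn_einf (fun p => elog (infRisk p) * ((s p)%:R * ln (p%:R : R))^-1%:E))%E.
Proof.
pose s := fun p : nat => Num.truncn ((p%:R : R) `^ (1 - alpha)).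
pose A := fun p : nat => Num.sqrt (2 * r * ln (p%:R : R) / (n p)%:R).
pose infRisk := fun p : nat =>
  inf [set Risk (P p) (X p) (eps p) (xi_test t) (s p) (A p) | t in [set: R]].
change ((- ((r - alpha) ^+ 2 / (4 * r)))%:E <
  limn_einf (fun p => elog (infRisk p) * ((s p)%:R * ln (p%:R : R))^-1%:E))%E.
have ha : 0 < alpha < 1 by case/andP: halpha => a0 a1; apply/andP; split; lra.
have r0 : 0 < r by case/andP: ha => a0 a1; lra.
(* The allowed exponent is [32 kappa]. The type I bound costs [8 kappa], additive constants another
   [8 kappa], and the gap between 16 and 32 gives strictness. *)
pose kappa := (r - alpha) ^+ 2 / (4 * r) / 32.
have k0 : 0 < kappa by rewrite divr_gt0 // divr_gt0 ?exprn_gt0 ?subr_gt0 // mulr_gt0.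
have kE : (r - alpha) ^+ 2 / (4 * r) = 32 * kappa by rewrite /kappa; field; rewrite gt_eqF.
(* [g] is the constant for which the Chernoff exponent [c * t0] below equals [g * b]. *)
pose g := Num.sqrt (kappa / (8 * r)).
have g0 : 0 < g by rewrite sqrtr_gt0 divr_gt0 // mulr_gt0.
(* [K1] comes from the union bound for bad designs; [K2] from [2 p exp (1 + c ^ 2 / 2 - g b)] with
   [c ^ 2 <= 1]. *)
have K1 : 0 < 64 * expR (sigma2 / 2) by rewrite mulr_gt0 // expR_gt0.
have K2 : 0 < 2 * expR 2 :> R by rewrite mulr_gt0 // expR_gt0.
have half0 : 0 < 2^-1 :> R by rewrite invr_gt0.
have [L1 HL1] := near_small ha half0 K1.
have [L2 HL2] := near_small ha g0 K2.
pose h := ((1 - alpha) / 8) ^+ 2 / 2.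
have h0 : 0 < h.
  by case/andP: ha => a0 a1; rewrite divr_gt0 // exprn_gt0 // divr_gt0 // subr_gt0.
(* [L1] and [L2] make the two error terms at most 1/4 each. The summands 1, [h^-1] and [(8 * r)^-1]
   yield [L >= 1], [b >= 1] and [c ^ 2 <= 1]; the last entry absorbs the additive constant 12. *)
pose L0 := Num.max (Num.max L1 L2)
  (Num.max (1 + h^-1 + (8 * r)^-1) (12 / (8 * kappa))).
rewrite kE; apply: (@lt_limn_einf _ _ _ (- (16 * kappa))%:E).
  by rewrite lte_fin; lra.
have nearL : \forall p \near \oo, L0 <= ln (p%:R : R) /\ (0 < p)%N.
  near=> p.
  have pe : expR L0 <= p%:R by near: p; exact: nbhs_infty_ger.
  have pp : (0 < p)%N by rewrite -(@ltr_nat R); apply: lt_le_trans pe; exact: expR_gt0.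
  by split => //; rewrite -[leLHS]expRK ler_ln // posrE ?expR_gt0 // ltr0n.
have nearn : \forall p \near \oo, (0 < n p)%N.
  have /cvgryPgt/(_ 0) := hn; apply: filterS => p; by rewrite ltr0n.
near=> p.
have [L0p p0] : L0 <= ln (p%:R : R) /\ (0 < p)%N by near: p.
have n0 : (0 < n p)%N by near: p.
set L := ln (p%:R : R) in L0p *.
have [L1p L2p L3p L4p] : [/\ L1 <= L, L2 <= L, 1 + h^-1 + (8 * r)^-1 <= L &
    12 / (8 * kappa) <= L].
  by move: L0p; rewrite /L0 !ge_max => /andP[/andP[? ?] /andP[? ?]].
have [s0] := sparsity_lower ha p0; rewrite -/h -/L -/(s p) => bL.
pose b := Num.sqrt (Num.sqrt (s p)%:R : R).
rewrite -/b in bL.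
have hi0 : 0 < h^-1 by rewrite invr_gt0.
have ri0 : 0 < (8 * r)^-1 by rewrite invr_gt0 mulr_gt0.
have L_ge1 : 1 <= L by lra.
have Lpos : 0 < L by lra.
have b1 : 1 <= b.
  apply: le_trans bL.
  have : 1 <= h * L by rewrite -ler_pdivrMl // mulr1; lra.
  by rewrite expr2; nra.
have b0 : 0 < b by exact: lt_le_trans b1.
have bE : b ^+ 2 * b ^+ 2 = (s p)%:R by rewrite sqr_sqrtr ?sqrtr_ge0 // -expr2 sqr_sqrtr.
have nR : 0 < (n p)%:R :> R by rewrite ltr0n.
have A0 : 0 < A p by rewrite sqrtr_gt0 divr_gt0 // !mulr_gt0.
have A2 : A p ^+ 2 = 2 * r * L / (n p)%:R by rewrite sqr_sqrtr // ltW // divr_gt0 // !mulr_gt0.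
pose C := 2 * b ^+ 2 * (n p)%:R.
have C0 : 0 <= C by rewrite !mulr_ge0 ?sqr_ge0 // ltW.
(* Since [b] is the fourth root of [s], [t0 ^ 2 = kappa s L]. *)
pose t0 := b ^+ 2 * Num.sqrt (kappa * L).
have t00 : 0 <= t0 by rewrite mulr_ge0 ?sqr_ge0 ?sqrtr_ge0.
(* Chosen so that the signal term [2 c ^ 2 A ^ 2 C] of the Chernoff bound equals 1. *)
pose c := Num.sqrt (8 * r * L)^-1 / b.
have c0 : 0 <= c by rewrite divr_ge0 ?sqrtr_ge0 // ltW.
have rL0 : 0 < 8 * r * L by rewrite !mulr_gt0.
have c2 : c ^+ 2 = (8 * r * L)^-1 / b ^+ 2.
  by rewrite /c expr_div_n sqr_sqrtr // invr_ge0 ltW.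
have bad : fine (P p (~` [set w | good_design C (X p w)])) <= 1 / 4.
  have b2 : 1 <= 2 * b ^+ 2 by nra.
  case: hdesign => [[hsub _]|[horth _]].
    apply: (le_trans (SubG_bad_design (hgauss p) (hsub p) n0 b2 (ltW b0))).
    apply: le_trans (HL1 p p0 L1p); rewrite -/(s p) -/b.
    have -> : b / 2 = 2^-1 * b by rewrite mulrC.
    by rewrite le_eqVlt; apply/orP; left; apply/eqP; ring.
  rewrite (Orth_bad_design (P p) (horth p) n0); first by rewrite divr_ge0.
  by rewrite /C ler_peMl // ltW.
have nondeg : P p [set w | \det ((X p w)^T *m X p w) != 0] = 1%E.
  case: hdesign => [[hsub _]|[horth _]]; first exact: (SubG_nondeg (hgauss p) (hsub p)).
  exact: (Orth_nondeg (P p) (horth p) n0).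
have ct0 : c * t0 = g * b.
  have -> : c * t0 = b * (Num.sqrt (8 * r * L)^-1 * Num.sqrt (kappa * L)).
    by rewrite /c /t0; field; rewrite gt_eqF.
  rewrite -sqrtrM ?invr_ge0 ?ltW // mulrC; congr (Num.sqrt _ * _).
  by field; rewrite !gt_eqF.
have cC : 2 * c ^+ 2 * A p ^+ 2 * C = 1.
  by rewrite c2 A2 /C; field; rewrite !gt_eqF.
have c1 : c ^+ 2 <= 1.
  rewrite c2 ler_pdivrMr ?exprn_gt0 // mul1r.
  apply: (@le_trans _ _ 1); last by nra.
  rewrite invf_le1 //.
  have : (8 * r)^-1 <= L by lra.
  by rewrite -ler_pdivrMl ?mulr_gt0 // mulr1.
have risk := @inf_risk_lower _ _ _ (P p) _ _ _ _ (hgauss p) t0 c (A p) C (s p) nondeg p0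
  (sparsity_le ha p0) A0 t00 c0 C0 _.
have {risk} : expR (- (2 * t0 + 2) ^+ 2) / 4 <= infRisk p.
  apply: risk; rewrite cC ct0.
  have := HL2 p p0 L2p; rewrite -/(s p) -/b.
  have : 2 * p%:R * expR (1 + c ^+ 2 / 2 - g * b) <= 2 * expR 2 * p%:R * expR (- (g * b)).
    rewrite expRD mulrA [leRHS](_ : _ = 2 * p%:R * expR 2 * expR (- (g * b))); last by ring.
    rewrite ler_pM2r ?expR_gt0 // ler_pM2l ?ler_expR; first lra.
    by rewrite mulr_gt0 // ltr0n.
  lra.
set q := infRisk p => qlow.
have t02 : t0 ^+ 2 = kappa * ((s p)%:R * L).
  rewrite /t0 exprMn -bE [X in _ * X = _]sqr_sqrtr; first by ring.
  by rewrite mulr_ge0 // ltW.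
(* [(2 t0 + 2) ^ 2 = 8 t0 ^ 2 + 8 - 4 (t0 - 1) ^ 2], and the factor 1/4 costs at most another 4
   because [exp 4 >= 4]. *)
have q1 : expR (- (8 * t0 ^+ 2 + 12)) <= q.
  apply: le_trans qlow; rewrite ler_pdivlMr //.
  apply: (@le_trans _ _ (expR (- (8 * t0 ^+ 2 + 12)) * expR 4)).
    by rewrite ler_pM2l ?expR_gt0 //; apply: le_trans (expR_ge1Dx 4); lra.
  rewrite -expRD ler_expR; have := sqr_ge0 (t0 - 1); rewrite !expr2; lra.
have q0 : 0 < q by apply: lt_le_trans q1; exact: expR_gt0.
rewrite /elog q0 -EFinM lee_fin.
have sR : 1 <= (s p)%:R :> R by rewrite ler1n.
have sL0 : 0 < (s p)%:R * L by rewrite mulr_gt0 // (lt_le_trans _ sR).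
rewrite ler_pdivlMr //.
have : - (8 * t0 ^+ 2 + 12) <= ln q.
  by rewrite -[leLHS]expRK ler_ln // posrE expR_gt0.
rewrite t02; apply: le_trans.
have : 12 <= L * (8 * kappa) by rewrite -ler_pdivrMr // mulr_gt0.
have : L <= (s p)%:R * L by rewrite ler_peMl // ltW.
move=> LsL L12.
have : 8 * kappa * L <= 8 * kappa * ((s p)%:R * L) by rewrite ler_pM2l // mulr_gt0.
lra.
Unshelve. all: by end_near. Qed.
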